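(* Let $H$ be a finite-dimensional pointed Hopf algebra over $\mathbb{C}$ with antipode $S$. Then $|S^2|$ divides $\exp(G(H))$.
   Context: A Hopf algebra is pointed if all its irreducible corepresentations are $1$-dimensional. $G(H)$ is the group of grouplike elements of $H$; the exponent $\exp(G)$ of a finite group $G$ is the least common multiple of the orders of its elements. $|S^2|$ denotes the order of $S^2$ as a linear automorphism of $H$ (finite by a theorem of Radford). *)

(* Defs.v *)
From HB Require Import structures.
From mathcomp Require Import all_boot all_order all_algebra all_fingroup.
From mathcomp Require Import all_solvable all_field.
From mathcomp Require Import boolp reals complex.

Set Implicit Arguments.
Unset Strict Implicit.
Unset Printing Implicit Defensive.

Import GRing.Theory.
Local Open Scope ring_scope.

Section Tensor.
Variable F : fieldType.

(* The tensor product of finite-dimensional spaces, realised as matrices of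
   coordinates; [tlift_pure] and [tensor_ext] below are the existence and
   uniqueness parts of its universal property. *)
Definition tensor (V W : vectType F) := 'M[F]_(\dim {:V}, \dim {:W}).

HB.instance Definition _ (V W : vectType F) :=
  Vector.on (tensor V W).

Definition pure (V W : vectType F) (v : V) (w : W) : tensor V W :=
  \matrix_(i, j) (coord (vbasis {:V}) i v * coord (vbasis {:W}) j w).

(* The linear map V (x) W -> U induced by b; meaningful for b bilinear. *)
Definition tlift (V W U : vectType F) (b : V -> W -> U) (t : tensor V W) : U :=
  \sum_i \sum_j
    (t : 'M_(_, _)) i j *: b (vbasis {:V})`_i (vbasis {:W})`_j.

Definition tmap (V W V' W' : vectType F) (f : V -> V') (g : W -> W') :
    tensor V W -> tensor V' W' :=
  tlift (fun v w => pure (f v) (g w)).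

Definition tassoc (U V W : vectType F) :
    tensor (tensor U V) W -> tensor U (tensor V W) :=
  tlift (fun t w => tlift (fun u v => pure u (pure v w)) t).

Definition tmul (A B : falgType F) (s t : tensor A B) : tensor A B :=
  tlift (fun a b => tlift (fun c d => pure (a * c) (b * d)) t) s.

Definition tspace (V W : vectType F) (X : {vspace V}) (Y : {vspace W}) :
    {vspace tensor V W} :=
  <<[seq pure x y | x <- vbasis X, y <- vbasis Y]>>%VS.

Lemma pure_linearl (V W : vectType F) (w : W) :
  linear (fun v : V => pure v w).
Proof.
by move=> a u v; apply/matrixP => i j; rewrite !mxE linearP /= mulrDl mulrA.
Qed.

Lemma pure_linearr (V W : vectType F) (v : V) :
  linear (fun w : W => pure v w).
Proof.
by move=> a w w'; apply/matrixP => i j; rewrite !mxE linearP /= mulrDr mulrCA.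
Qed.

Lemma tlift_linear (V W U : vectType F) (b : V -> W -> U) : linear (tlift b).
Proof.
move=> a s t; rewrite /tlift scaler_sumr -big_split; apply: eq_bigr => i _ /=.
rewrite scaler_sumr -big_split; apply: eq_bigr => j _ /=.
by rewrite !mxE scalerDl scalerA.
Qed.

Lemma vect_coordE (V : vectType F) (v : V) :
  v = \sum_i coord (vbasis {:V}) i v *: (vbasis {:V})`_i.
Proof. exact: coord_vbasis (memvf v). Qed.

Lemma coord_vbasisE (V : vectType F) (i j : 'I_(\dim {:V})) :
  coord (vbasis {:V}) i (vbasis {:V})`_j = (i == j)%:R.
Proof. by rewrite (coord_free _ _ (basis_free (vbasisP _))) eq_sym. Qed.

Lemma tlift_pure (V W U : vectType F) (b : V -> W -> U) v w :
  (forall w', linear (b^~ w')) -> (forall v', linear (b v')) ->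
  tlift b (pure v w) = b v w.
Proof.
move=> bl br.
pose Bl w' := GRing.isLinear.Build F V U *:%R (b^~ w') (bl w').
pose bL w' : {linear V -> U} := HB.pack (b^~ w') (Bl w').
pose Br v' := GRing.isLinear.Build F W U *:%R (b v') (br v').
pose bR v' : {linear W -> U} := HB.pack (b v') (Br v').
have -> : b v w = bL w v by [].
rewrite [in RHS](vect_coordE v) linear_sum /tlift; apply: eq_bigr => i _.
rewrite linearZ /= -[b _ w]/(bR (vbasis {:V})`_i w).
rewrite [in RHS](vect_coordE w) linear_sum scaler_sumr.
apply: eq_bigr => j _.
by rewrite linearZ /= scalerA mxE.
Qed.

Lemma tensor_decomp (V W : vectType F) (t : tensor V W) :
  t = tlift (fun v w => pure v w) t.
Proof.
apply/matrixP => i j; rewrite /tlift summxE (bigD1 i) //= [X in _ + X]big1.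
  rewrite addr0 summxE (bigD1 j) //= [X in _ + X]big1 ?addr0 => [|k nkj].
    by rewrite !mxE !coord_vbasisE !eqxx !mulr1.
  by rewrite !mxE !coord_vbasisE [j == k]eq_sym (negPf nkj) !mulr0.
move=> k nki; rewrite summxE big1 // => l _.
by rewrite !mxE !coord_vbasisE [i == k]eq_sym (negPf nki) mul0r mulr0.
Qed.

Lemma tensor_ext (V W U : vectType F) (f g : tensor V W -> U) :
  linear f -> linear g -> (forall v w, f (pure v w) = g (pure v w)) -> f =1 g.
Proof.
move=> lf lg fg t.
pose Bf := GRing.isLinear.Build F _ U *:%R f lf.
pose Bg := GRing.isLinear.Build F _ U *:%R g lg.
pose f' : {linear tensor V W -> U} := HB.pack f Bf.
pose g' : {linear tensor V W -> U} := HB.pack g Bg.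
rewrite -[f t]/(f' t) -[g t]/(g' t) (tensor_decomp t) !linear_sum.
apply: eq_bigr => i _; rewrite !linear_sum; apply: eq_bigr => j _.
by rewrite !linearZ /= fg.
Qed.

Lemma tmul_pure (A B : falgType F) (a c : A) (b d : B) :
  tmul (pure a b) (pure c d) = pure (a * c) (b * d).
Proof.
have mull x y y' : linear (fun x' : A => pure (x * x') (y * y' : B)).
  by move=> k u v; rewrite mulrDr -scalerAr pure_linearl.
have mulr x y x' : linear (fun y' : B => pure (x * x' : A) (y * y')).
  by move=> k u v; rewrite mulrDr -scalerAr pure_linearr.
have tmulE x y x' y' : tlift (fun c d => pure (x * c) (y * d)) (pure x' y')
    = pure (x * x') (y * y') :> tensor A B.
  by rewrite (tlift_pure _ _ (mull x y) (mulr x y)).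
have comb (W : vectType F) (b1 b2 : A -> B -> W) k :
    linear (fun t => k *: tlift b1 t + tlift b2 t).
  move=> l s t; rewrite !tlift_linear !scalerDr !scalerA [l * k]mulrC.
  by rewrite -!addrA; congr (_ + _); rewrite addrCA.
rewrite /tmul tlift_pure ?tmulE // => [y|x] k u v; move: (pure c d).
  apply: tensor_ext => [||x' y']; [exact: tlift_linear|exact: comb|].
  by rewrite !tmulE mulrDl -scalerAl pure_linearl.
apply: tensor_ext => [||x' y']; [exact: tlift_linear|exact: comb|].
by rewrite !tmulE mulrDl -scalerAl pure_linearr.
Qed.

Lemma tmul_linearl (A B : falgType F) (t : tensor A B) :
  linear (fun s => tmul s t).
Proof. exact: tlift_linear. Qed.

Lemma tmulA_pure (A B : falgType F) (s : tensor A B) a b c d :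
  tmul s (tmul (pure a b) (pure c d)) = tmul (tmul s (pure a b)) (pure c d).
Proof.
move: s; apply: tensor_ext => [|k s s'|v w]; first exact: tmul_linearl.
  by rewrite !tmul_linearl.
by rewrite !tmul_pure !mulrA.
Qed.

Lemma tmul1_pure (A B : falgType F) (t : tensor A B) :
  tmul t (pure 1 1) = t.
Proof.
move: t; apply: tensor_ext => [||v w]; first exact: tmul_linearl; first by [].
by rewrite tmul_pure !mulr1.
Qed.

End Tensor.

HB.mixin Record isCoalgebra (F : fieldType) C of Vector F C := {
  comul : {linear C -> tensor C C};
  counit : {scalar C};
  coassoc : forall x : C,
    tassoc (tmap comul idfun (comul x)) = tmap idfun comul (comul x);
  counitl : forall x : C, tlift (fun a b : C => counit a *: b) (comul x) = x;
  counitr : forall x : C, tlift (fun a b : C => counit b *: a) (comul x) = x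
}.

#[short(type="coalgType")]
HB.structure Definition Coalgebra (F : fieldType) :=
  { C of Vector F C & isCoalgebra F C }.

HB.mixin Record isBialgebra (F : fieldType) H
    of Falgebra F H & Coalgebra F H := {
  comul1 : comul (1 : H) = pure (1 : H) (1 : H);
  comulM : forall x y : H, comul (x * y) = tmul (comul x) (comul y);
  counit1 : counit (1 : H) = 1;
  counitM : forall x y : H, counit (x * y) = counit x * counit y
}.

#[short(type="bialgType")]
HB.structure Definition Bialgebra (F : fieldType) :=
  { H of Falgebra F H & Coalgebra F H & isBialgebra F H }.

HB.mixin Record hasAntipode (F : fieldType) H of Bialgebra F H := {
  antipode : {linear H -> H};
  antipodel : forall x : H,
    tlift (fun a b : H => antipode a * b) (comul x) = (counit x)%:A;
  antipoder : forall x : H,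
    tlift (fun a b : H => a * antipode b) (comul x) = (counit x)%:A
}.

#[short(type="hopfAlgType")]
HB.structure Definition HopfAlgebra (F : fieldType) :=
  { H of Bialgebra F H & hasAntipode F H }.

HB.mixin Record isComodule (F : fieldType) (C : coalgType F) V
    of Vector F V := {
  coact : {linear V -> tensor V C};
  coactA : forall v : V,
    tassoc (tmap coact idfun (coact v)) = tmap idfun comul (coact v);
  coact1 : forall v : V,
    tlift (fun (u : V) (c : C) => counit c *: u) (coact v) = v
}.

#[short(type="comodType")]
HB.structure Definition Comodule (F : fieldType) (C : coalgType F) :=
  { V of Vector F V & isComodule F C V }.

(* Irreducible corepresentations of a finite-dimensional coalgebra are
   finite-dimensional, so comodules are taken to be so from the start. *)
Definition irreducible_comod (F : fieldType) (C : coalgType F)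
    (V : comodType C) : Prop :=
  (\dim {:V} != 0)%N /\
  forall U : {vspace V},
    (forall u : V, u \in U -> coact u \in tspace U {:C}) ->
    U = 0%VS \/ U = fullv.

Definition pointed_coalg (F : fieldType) (C : coalgType F) : Prop :=
  forall V : comodType C, irreducible_comod V -> \dim {:V} = 1%N.

Section Grouplike.
Variables (F : fieldType) (H : hopfAlgType F).

Definition is_grouplike (g : H) : bool :=
  (g != 0) && (comul g == pure g g).

Record grouplike :=
  Grouplike { grouplike_val :> H; _ : is_grouplike grouplike_val }.

HB.instance Definition _ := [isSub for grouplike_val].
HB.instance Definition _ := [Choice of grouplike by <:].

Lemma counit_grouplike (g : H) : is_grouplike g -> counit g = 1.
Proof.
case/andP=> g0 /eqP Dg; have := counitl g; rewrite Dg tlift_pure.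
- move=> eg; apply/eqP; rewrite -subr_eq0 -[_ == 0]orbF -(negPf g0).
  by rewrite -scaler_eq0 scalerBl scale1r eg subrr.
- by move=> w k u v; rewrite linearP scalerDl scalerA.
- by move=> v k w w'; rewrite scalerDr !scalerA mulrC.
Qed.

Lemma antipode_grouplike_mull (g : H) : is_grouplike g -> antipode g * g = 1.
Proof.
move=> gg; have := antipodel g; rewrite counit_grouplike // scale1r.
case/andP: gg => _ /eqP ->; rewrite tlift_pure // => [w|v] k u u'.
  by rewrite linearP mulrDl -scalerAl.
by rewrite mulrDr -scalerAr.
Qed.

Lemma antipode_grouplike_mulr (g : H) : is_grouplike g -> g * antipode g = 1.
Proof.
move=> gg; have := antipoder g; rewrite counit_grouplike // scale1r.
case/andP: gg => _ /eqP ->; rewrite tlift_pure // => [w|v] k u u'.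
  by rewrite mulrDl -scalerAl.
by rewrite linearP mulrDr -scalerAr.
Qed.

Lemma is_grouplike1 : is_grouplike 1.
Proof. by rewrite /is_grouplike oner_neq0 comul1 eqxx. Qed.

Lemma is_grouplikeM (g h : H) :
  is_grouplike g -> is_grouplike h -> is_grouplike (g * h).
Proof.
move=> gg gh; apply/andP; split; last first.
  case/andP: gg => _ /eqP Dg; case/andP: gh => _ /eqP Dh.
  by rewrite comulM Dg Dh tmul_pure.
apply/eqP => gh0; have /eqP := counitM g h.
by rewrite gh0 linear0 !counit_grouplike // mul1r eq_sym oner_eq0.
Qed.

Lemma is_grouplikeV (g : H) : is_grouplike g -> is_grouplike (antipode g).
Proof.
move=> gg; have SgK := antipode_grouplike_mull gg.
have gSK := antipode_grouplike_mulr gg; apply/andP; split.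
  by apply/eqP => Sg0; move: SgK; rewrite Sg0 mul0r => /eqP;
     rewrite eq_sym oner_eq0.
have := comulM (antipode g) g; rewrite SgK comul1.
case/andP: gg => _ /eqP -> E; apply/eqP.
rewrite -[LHS]tmul1_pure -gSK -tmul_pure tmulA_pure -E.
by rewrite tmul_pure !mul1r.
Qed.

Lemma grouplike_free (s : seq H) :
  uniq s -> {in s, forall g, is_grouplike g} -> free s.
Proof.
elim: s => [|g s IHs] /=; first by rewrite nil_free.
case/andP=> gNs Us gl; have {IHs} fs : free s.
  by apply: IHs => // h hs; apply: gl; rewrite inE hs orbT.
rewrite free_cons fs andbT; apply/negP => gs.
have /andP[g0 /eqP Dg] := gl g (mem_head _ _).
pose c := coord (in_tuple s); pose X i := (in_tuple s)`_i.
have gE : g = \sum_i c i g *: X i by rewrite /c /X -coord_span.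
have Xs (i : 'I_(size s)) : X i \in s by exact: (mem_nth 0 (ltn_ord i)).
have DX (i : 'I_(size s)) : comul (X i) = pure (X i) (X i).
  have /andP[_ /eqP//] : is_grouplike (X i).
  by apply: gl; rewrite inE Xs orbT.
have cX (i j : 'I_(size s)) : c i (X j) = (j == i)%:R by rewrite /c coord_free.
pose b i j := tlift (fun u v : H => (c i u * c j v : F^o)).
have bpure i j u v : b i j (pure u v) = c i u * c j v.
  rewrite /b tlift_pure // => [w k x y|w k x y].
    by rewrite /c linearP mulrDl -mulrA.
  by rewrite /c linearP mulrDr mulrCA.
have blin i j (I : finType) (k : I -> F) (x : I -> tensor H H) :
    b i j (\sum_l k l *: x l) = \sum_l k l * b i j (x l).
  rewrite /b; elim/big_rec2: _ => [|l y1 y2 _ <-].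
    by have := tlift_linear (fun u v : H => (c i u * c j v : F^o)) (-1) 0 0;
       rewrite scaler0 addr0 scaleN1r addNr.
  by rewrite tlift_linear.
have cc i j : c i g * c j g = if i == j then c i g else 0.
  rewrite -bpure -Dg [in LHS]gE linear_sum.
  under eq_bigr do rewrite linearZ /= DX.
  rewrite blin (bigD1 i) //= bpure !cX eqxx mul1r big1 ?addr0.
    by case: eqP; rewrite ?mulr1 ?mulr0.
  by move=> l nli; rewrite bpure cX (negPf nli) mul0r mulr0.
have [i ci] : exists i, c i g != 0.
  apply/existsP; apply: contraNT g0 => /existsPn ci.
  rewrite gE big1 // => i _; have /eqP-> := negbNE (ci i).
  by rewrite scale0r.
have ci1 : c i g = 1 by apply: (mulfI ci); rewrite cc eqxx mulr1.
case/negP: gNs; rewrite gE (bigD1 i) //= big1.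
  by rewrite addr0 ci1 scale1r Xs.
move=> j nji; apply/eqP; rewrite scaler_eq0 -[c j g]mulr1 -ci1 cc.
by rewrite (negPf nji) eqxx.
Qed.

Lemma grouplike_fin : exists s : seq H, forall g, is_grouplike g -> g \in s.
Proof.
pose P n := `[< exists s : seq H,
  [/\ uniq s, {in s, forall g, is_grouplike g} & size s = n] >].
have P0 : exists n, P n by exists 0%N; apply/asboolP; exists [::].
have Pb n : P n -> (n <= \dim {:H})%N.
  case/asboolP=> s [Us /(grouplike_free Us) /eqP <- <-].
  exact/dimvS/subvf.
case: (ex_maxnP P0 Pb) => n /asboolP[s [Us gl sz]] mx.
exists s => g gg; apply: contraTT (ltnSn n) => gNs; rewrite -leqNgt.
apply: mx; apply/asboolP; exists (g :: s); split => /=; rewrite ?gNs ?sz //.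
by move=> h; rewrite inE => /predU1P[->|/gl].
Qed.

Let gl_seq : seq H := sval (cid grouplike_fin).

Lemma gl_seqP (g : grouplike) : grouplike_val g \in gl_seq.
Proof. by rewrite /gl_seq; case: cid => s /= -> //; case: g. Qed.

Let to_seq (g : grouplike) : seq_sub gl_seq := SeqSub (gl_seqP g).
Let of_seq (x : seq_sub gl_seq) : option grouplike := insub (ssval x).
Lemma to_seqK : pcancel to_seq of_seq.
Proof. by move=> g; rewrite /of_seq /= valK. Qed.

HB.instance Definition _ := isCountable.Build grouplike (pcan_pickleK to_seqK).
HB.instance Definition _ := isFinite.Build grouplike (pcan_enumP to_seqK).

Definition gl1 := Grouplike is_grouplike1.
Definition gl_mul (g h : grouplike) :=
  Grouplike (is_grouplikeM (valP g) (valP h)).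
Definition gl_inv (g : grouplike) := Grouplike (is_grouplikeV (valP g)).

Lemma gl_mulA : associative gl_mul.
Proof. by move=> x y z; apply: val_inj; rewrite /= mulrA. Qed.

Lemma gl_mul1 : left_id gl1 gl_mul.
Proof. by move=> x; apply: val_inj; rewrite /= mul1r. Qed.

Lemma gl_mulV : left_inverse gl1 gl_inv gl_mul.
Proof. by move=> [x gx]; apply: val_inj; exact: antipode_grouplike_mull. Qed.

HB.instance Definition _ :=
  Finite_isGroup.Build grouplike gl_mulA gl_mul1 gl_mulV.

End Grouplike.

(* The least n > 0 with f^n = id, or 0 if f has infinite order. *)
Definition fun_order (T : Type) (f : T -> T) : nat :=
  if pselect (exists n, (0 < n)%N && `[< iter n f =1 id >]) is left ex
  then ex_minn ex else 0%N.

(* Main.v *)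
Require Import Defs.
From HB Require Import structures.
From mathcomp Require Import all_boot all_order all_algebra all_fingroup.
From mathcomp Require Import all_solvable all_field.
From mathcomp Require Import boolp reals complex.

Set Implicit Arguments.
Unset Strict Implicit.
Unset Printing Implicit Defensive.

Import GRing.Theory.
Local Open Scope ring_scope.

(** Let [N] be the exponent of the group of grouplike elements of the pointed
    Hopf algebra [H], with antipode [S], and let [f] be [S^(2N)]; the claim is
    that [f] is the identity.

    The map [f] fixes the grouplike elements, and also the skew primitive ones:
    if [y] has coproduct [y (x) a + b (x) y] with [a] and [b] grouplike, then
    [S^2 y = u y v] for the grouplike elements [u = a b^-1] and [v = a^-1 b],
    which [S^2] fixes, so that [f y = u^N y v^N = y].  Now let [C] be a proper
    subcoalgebra that contains the grouplike elements and is fixed pointwise by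
    [f].  Since [H] is pointed, some [x] outside [C] has coproduct
    [x (x) a + b (x) x] modulo [C (x) C], with [a] and [b] grouplike
    ([socle_hitl], [socle_hitr]).  Then [y = f x - x] is skew primitive, hence
    fixed by [f], and the [M]-th iterate of [f] sends [x] to [x + M y].  When
    [M] is a positive multiple of the order of [f], this gives [M y = 0], so
    [y = 0] in characteristic 0, and [C + <x>] is a larger subcoalgebra fixed
    by [f] ([fixed_extend]).  Induction on the codimension of [C] concludes.

    Two facts remain.  The first is the existence of [x].  The functionals on
    [H] that vanish on the grouplike elements form a nilpotent ideal of the
    dual algebra ([glann_nilpotent]): any nonzero subcomodule of [H] has a
    quotient isomorphic to a simple subcomodule of [H], that is, to a line
    spanned by a grouplike element.  Modulo this ideal the dual algebra is a
    product of copies of the field, one for each grouplike element.  So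
    subquotients of its representations, left or right, contain eigenvectors
    whose eigenvalues are evaluations at grouplike elements
    ([socle_eigenvector]).

    The second is that [S] has finite order.  It follows from Radford's formula
    [alpha -> y = g S^4(y <- alpha) g^-1], with [g] a grouplike element and
    [alpha] a character of the algebra [H] ([radford]): [g] has finite order
    because there are finitely many grouplike elements, and [alpha] because
    distinct characters are linearly independent.  The formula comes from a
    nonzero integral [lam] by computing its Nakayama automorphism in two ways.
    For pointed [H] both the existence of [lam] and its nondegeneracy are short:
    [lam] is a translate of an eigenvector of the dual algebra acting on itself,
    and the degenerate elements form a subcomodule without grouplike elements,
    which must be zero. *)

(** * Multilinearity *)

Section Linearity.
Variable F : fieldType.
Implicit Types U V W : lmodType F.

Lemma linear_eq0 V W (f : V -> W) : linear f -> f 0 = 0.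
Proof.
by move=> lf; have := lf (-1) 0 0; rewrite scaler0 addr0 scaleN1r addNr.
Qed.

Lemma linear_eqZ V W (f : V -> W) k v : linear f -> f (k *: v) = k *: f v.
Proof. by move=> lf; rewrite -[k *: v]addr0 lf linear_eq0 // addr0. Qed.

Lemma linear_id V : linear (fun x : V => x). Proof. by []. Qed.

Lemma linear_comp U V W (f : V -> W) (g : U -> V) :
  linear f -> linear g -> linear (fun x => f (g x)).
Proof. by move=> lf lg k u v; rewrite lg lf. Qed.

Lemma linear_app U V W (f : {linear V -> W}) (g : U -> V) :
  linear g -> linear (fun x => f (g x)).
Proof. by move=> lg k u v; rewrite lg linearP. Qed.

Lemma linear_scalel U V (f : U -> F) (v : V) :
  linear (f : U -> F^o) -> linear (fun x => f x *: v).
Proof. by move=> lf k x y; rewrite lf scalerDl -scalerA. Qed.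

Lemma linear_scaler U V (c : F) (f : U -> V) :
  linear f -> linear (fun x => c *: f x).
Proof. by move=> lf k x y; rewrite lf scalerDr !scalerA mulrC. Qed.

Lemma linear_mull U (A : algType F) (f : U -> A) (c : A) :
  linear f -> linear (fun x => f x * c).
Proof. by move=> lf k x y; rewrite lf mulrDl scalerAl. Qed.

Lemma linear_mulr U (A : algType F) (c : A) (f : U -> A) :
  linear f -> linear (fun x => c * f x).
Proof. by move=> lf k x y; rewrite lf mulrDr scalerAr. Qed.

Lemma linear_smull U (f : U -> F) (c : F) :
  linear (f : U -> F^o) -> linear (fun x => f x * c : F^o).
Proof.
by move=> lf k x y; rewrite lf mulrDl; congr (_ + _); exact/esym/mulrA.
Qed.

Lemma linear_smulr U (c : F) (f : U -> F) :
  linear (f : U -> F^o) -> linear (fun x => c * f x : F^o).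
Proof. by move=> lf k x y; rewrite lf mulrDr; congr (_ + _); exact: mulrCA. Qed.

Lemma linear_purel U (V W : vectType F) (f : U -> V) (w : W) :
  linear f -> linear (fun x => pure (f x) w).
Proof. by move=> lf k x y; rewrite lf pure_linearl. Qed.

Lemma linear_purer U (V W : vectType F) (v : V) (f : U -> W) :
  linear f -> linear (fun x => pure v (f x)).
Proof. by move=> lf k x y; rewrite lf pure_linearr. Qed.

Lemma linear_tlift U (V W X : vectType F) (b : V -> W -> X) f :
  linear f -> linear (fun x : U => tlift b (f x)).
Proof. by move=> lf k x y; rewrite lf tlift_linear. Qed.

Lemma linear_tlift_fun U (V W X : vectType F) (b : U -> V -> W -> X) t :
  (forall v w, linear (fun x => b x v w)) ->
  linear (fun x : U => tlift (b x) t).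
Proof.
move=> lb k x y; rewrite /tlift scaler_sumr -big_split; apply: eq_bigr => i _ /=.
rewrite scaler_sumr -big_split; apply: eq_bigr => j _ /=.
by rewrite lb scalerDr !scalerA mulrC.
Qed.

Lemma tliftD (V W U : vectType F) (b : V -> W -> U) s t :
  tlift b (s + t) = tlift b s + tlift b t.
Proof. by have := tlift_linear b 1 s t; rewrite !scale1r. Qed.

Lemma linear_tmull U (A B : falgType F) (f : U -> tensor A B) (t : tensor A B) :
  linear f -> linear (fun x => tmul (f x) t).
Proof. by move=> lf k x y; rewrite lf tmul_linearl. Qed.

Lemma linear_tmulr U (A B : falgType F) (t : tensor A B) (f : U -> tensor A B) :
  linear f -> linear (fun x => tmul t (f x)).
Proof.
move=> lf; apply: linear_tlift_fun => v w; exact: linear_tlift.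
Qed.

End Linearity.

Section Hom.
Variables (F : fieldType) (V W : vectType F) (f : V -> W) (lf : linear f).

Definition mkhom : 'Hom(V, W) :=
  linfun (HB.pack_for {linear V -> W} f (GRing.isLinear.Build F V W *:%R f lf)).

Lemma mkhomE x : mkhom x = f x.
Proof. by rewrite lfunE. Qed.

End Hom.

(** * The dual space *)

Section Dual.
Variables (F : fieldType) (C : vectType F).

Definition dual := 'Hom(C, F^o).
HB.instance Definition _ := Vector.on dual.

(** Evaluation with values in [F] instead of [F^o]. *)
Definition dapp (p : dual) (x : C) : F := (p : 'Hom(C, F^o)) x.
Coercion dapp : dual >-> Funclass.

Lemma linear_dapp (U : lmodType F) (p : dual) (g : U -> C) :
  linear g -> linear (fun x => p (g x) : F^o).
Proof. by move=> lg k u v; rewrite lg /dapp linearP. Qed.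

Lemma dappD (p q : dual) x : dapp (p + q) x = p x + q x.
Proof. by rewrite /dapp add_lfunE. Qed.

Lemma dappZ k (p : dual) x : dapp (k *: p) x = k * p x.
Proof. by rewrite /dapp scale_lfunE. Qed.

Lemma dappB (p q : dual) x : dapp (p - q) x = p x - q x.
Proof. by rewrite /dapp add_lfunE opp_lfunE. Qed.

Lemma dapp_sum I (r : seq I) (P : pred I) (p : I -> dual) x :
  dapp (\sum_(i <- r | P i) p i) x = \sum_(i <- r | P i) p i x.
Proof. by rewrite /dapp sum_lfunE. Qed.

Lemma dapp0l x : dapp 0 x = 0.
Proof. by rewrite /dapp zero_lfunE. Qed.

Lemma dapp0 (p : dual) : p 0 = 0.
Proof. by rewrite /dapp linear0. Qed.

Lemma dappDr (p : dual) x y : p (x + y) = p x + p y.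
Proof. by rewrite /dapp linearD. Qed.

Lemma dappBr (p : dual) x y : p (x - y) = p x - p y.
Proof. by rewrite /dapp linearB. Qed.

Lemma dappZr (p : dual) k x : p (k *: x) = k * p x.
Proof. by rewrite /dapp linearZ. Qed.

Lemma dual_ext (p q : dual) : (forall x, p x = q x) -> p = q.
Proof. by move=> e; apply/lfunP => x; exact: e. Qed.

Definition mkdual (f : C -> F) (lf : linear (f : C -> F^o)) : dual :=
  mkhom lf.

Lemma mkdualE (f : C -> F) (lf : linear (f : C -> F^o)) x : mkdual lf x = f x.
Proof. exact: (@mkhomE _ _ F^o). Qed.

Fact coord_linear i : linear (coord (vbasis {:C}) i : C -> F^o).
Proof. exact: linearP. Qed.

Definition dcoord i : dual := mkdual (coord_linear i).

Lemma dcoordE i x : dcoord i x = coord (vbasis {:C}) i x.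
Proof. exact: mkdualE. Qed.

Lemma dual_sep x : (forall p : dual, p x = 0) -> x = 0.
Proof.
move=> px; rewrite (vect_coordE x) big1 // => i _.
by rewrite -dcoordE px scale0r.
Qed.

Lemma dual_dim : \dim {:dual} = \dim {:C}.
Proof. by rewrite !dimvf /dim /= muln1. Qed.

End Dual.

(** The tactic [lin] proves the linearity of an expression in one of its
    variables, by following the structure of the expression. *)
Create HintDb lin.
#[export] Hint Extern 1 (linear _) => apply: linear_id : lin.
#[export] Hint Extern 2 (linear _) => apply: linear_scalel : lin.
#[export] Hint Extern 2 (linear _) => apply: linear_scaler : lin.
#[export] Hint Extern 2 (linear _) => apply: linear_mull : lin.
#[export] Hint Extern 2 (linear _) => apply: linear_mulr : lin.
#[export] Hint Extern 2 (linear _) => apply: linear_smull : lin.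
#[export] Hint Extern 2 (linear _) => apply: linear_smulr : lin.
#[export] Hint Extern 2 (linear _) => apply: linear_purel : lin.
#[export] Hint Extern 2 (linear _) => apply: linear_purer : lin.
#[export] Hint Extern 2 (linear _) => apply: linear_tlift : lin.
#[export] Hint Extern 2 (linear _) => apply: linear_tlift_fun : lin.
#[export] Hint Extern 2 (linear _) => apply: linear_tmull : lin.
#[export] Hint Extern 2 (linear _) => apply: linear_tmulr : lin.
#[export] Hint Extern 3 (linear _) => apply: linear_app : lin.
#[export] Hint Extern 2 (linear _) => refine (linear_dapp _ _) : lin.
Ltac lin := try by intros; eauto 20 with lin nocore.

(** * Sweedler sums *)

Section Sweedler.
Variables (F : fieldType) (C : coalgType F).
Implicit Types (V W : vectType F) (x : C).

(** The sum of the [b x_1 x_2] in Sweedler's notation.  Iterated coproducts are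
    nested sums: [sw (fun a b => sw (t a) b) x] is the sum of the
    [t x_1 x_2 x_3], and so is the nesting on the other side, by
    [sw_coassoc]. *)
Definition sw V (b : C -> C -> V) (x : C) : V := tlift b (comul x).

Lemma linear_sw (U : lmodType F) V (b : C -> C -> V) (f : U -> C) :
  linear f -> linear (fun u => sw b (f u)).
Proof. by move=> lf; apply: linear_tlift; apply: linear_app. Qed.

Lemma linear_sw_fun (U : lmodType F) V (b : U -> C -> C -> V) x :
  (forall v w, linear (fun u => b u v w)) -> linear (fun u => sw (b u) x).
Proof. exact: linear_tlift_fun. Qed.

End Sweedler.

#[export] Hint Extern 2 (linear _) => apply: linear_sw : lin.
#[export] Hint Extern 2 (linear _) => apply: linear_sw_fun : lin.

Section SweedlerTheory.
Variables (F : fieldType) (C : coalgType F).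
Implicit Types (V W : vectType F) (x : C).

Lemma eq_sw V (b b' : C -> C -> V) x :
  (forall a c, b a c = b' a c) -> sw b x = sw b' x.
Proof.
by move=> e; rewrite /sw /tlift; do 2!(apply: eq_bigr => ? _); rewrite e.
Qed.

(** The same with both sides read in [F]: the vector space [F^o] cannot be
    recovered from such an equation. *)
Lemma eq_sws (b b' : C -> C -> F) x :
  (forall a c, b a c = b' a c) ->
  sw (b : C -> C -> F^o) x = sw (b' : C -> C -> F^o) x :> F.
Proof. exact: (@eq_sw F^o). Qed.

Lemma sw_app V W (f : {linear V -> W}) (b : C -> C -> V) x :
  f (sw b x) = sw (fun c d => f (b c d)) x.
Proof.
rewrite /sw /tlift linear_sum; apply: eq_bigr => i _.
by rewrite linear_sum; apply: eq_bigr => j _; rewrite linearZ.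
Qed.

Lemma sw_lin V W (f : V -> W) (b : C -> C -> V) x :
  linear f -> f (sw b x) = sw (fun c d => f (b c d)) x.
Proof.
move=> lf; pose B := GRing.isLinear.Build F V W *:%R f lf.
pose f' : {linear V -> W} := HB.pack f B.
exact: (sw_app f').
Qed.

Lemma sw_dapp V (p : dual V) (b : C -> C -> V) x :
  p (sw b x) = sw (fun c d => p (b c d) : F^o) x.
Proof. by apply: (sw_lin (f := fun v => p v : F^o)); lin. Qed.

Lemma sw_sum V (I : finType) (b : I -> C -> C -> V) x :
  sw (fun a c => \sum_i b i a c) x = \sum_i sw (b i) x.
Proof.
rewrite /sw /tlift [RHS]exchange_big; apply: eq_bigr => j _ /=.
rewrite [RHS]exchange_big; apply: eq_bigr => k _ /=.
by rewrite scaler_sumr.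
Qed.

Lemma sw_swap V (b : C -> C -> C -> C -> V) x y :
  sw (fun a c => sw (b a c) y) x = sw (fun d e => sw (fun a c => b a c d e) x) y.
Proof.
transitivity (sw (fun a c : C => \sum_d \sum_e ((comul y : 'M_(_, _)) d e) *:
    b a c (vbasis {:C})`_d (vbasis {:C})`_e) x); first by apply: eq_sw.
rewrite /sw /tlift.
under eq_bigr do under eq_bigr do rewrite scaler_sumr.
under eq_bigr do rewrite exchange_big /=.
rewrite exchange_big /=; apply: eq_bigr => d _.
under eq_bigr do under eq_bigr do rewrite scaler_sumr.
under eq_bigr do rewrite exchange_big /=.
rewrite exchange_big /=; apply: eq_bigr => e _.
rewrite scaler_sumr; apply: eq_bigr => i _.
rewrite scaler_sumr; apply: eq_bigr => j _.
by rewrite !scalerA mulrC.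
Qed.

Lemma sw_coassoc V (t : C -> C -> C -> V) x :
  (forall b c, linear (fun a => t a b c)) ->
  (forall a c, linear (fun b => t a b c)) ->
  (forall a b, linear (fun c => t a b c)) ->
  sw (fun a b => sw (fun c d => t c d b) a) x =
  sw (fun a b => sw (fun c d => t a c d) b) x.
Proof.
move=> l1 l2 l3.
have lT a : linear (tlift (t a)) by apply: linear_tlift; lin.
pose T := tlift (fun a => tlift (t a)).
have Tp a b c : T (pure a (pure b c)) = t a b c.
  rewrite /T tlift_pure; first by rewrite tlift_pure.
    by move=> u; apply: linear_tlift_fun => v w; exact: l1.
  exact: lT.
have -> : sw (fun a b => sw (fun c d => t a c d) b) x =
    T (tmap idfun comul (comul x)).
  rewrite /sw; move: (comul x); apply: tensor_ext.
  - exact: linear_tlift.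
  - by rewrite /T /tmap; lin.
  move=> v w; rewrite tlift_pure.
  - rewrite /tmap tlift_pure /=; [|by lin..].
    rewrite /T tlift_pure //.
    by move=> u; apply: linear_tlift_fun => ? ?; exact: l1.
  - by move=> u; apply: linear_tlift_fun => ? ?; exact: l1.
  - by lin.
rewrite -coassoc /sw; move: (comul x); apply: tensor_ext.
- exact: linear_tlift.
- by rewrite /T /tassoc /tmap; lin.
move=> v w; rewrite tlift_pure; last first.
- by move=> u; apply: linear_tlift_fun => ? ?; exact: l3.
- by lin.
rewrite /tmap tlift_pure /=; [|by lin..].
rewrite /tassoc tlift_pure; [|by lin..].
move: (comul v); apply: tensor_ext.
- exact: linear_tlift.
- by rewrite /T; lin.
move=> a b; rewrite !tlift_pure // ?Tp //; by lin.
Qed.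

Fact counit_linear : linear (counit : C -> F^o).
Proof. exact: linearP. Qed.
Definition eps : dual C := mkdual counit_linear.
Lemma epsE x : eps x = counit x. Proof. exact: mkdualE. Qed.

Lemma sw_epsl V (f : C -> V) x : linear f ->
  sw (fun a b => eps a *: f b) x = f x.
Proof.
move=> lf; rewrite -[in RHS](counitl x) [in RHS](sw_lin _ _ lf).
by apply: eq_sw => a b; rewrite epsE linear_eqZ.
Qed.

Lemma sw_epsr V (f : C -> V) x : linear f ->
  sw (fun a b => eps b *: f a) x = f x.
Proof.
move=> lf; rewrite -[in RHS](counitr x) [in RHS](sw_lin _ _ lf).
by apply: eq_sw => a b; rewrite epsE linear_eqZ.
Qed.

End SweedlerTheory.

(** * The dual algebra and its two actions *)

Section Hits.
Variables (F : fieldType) (C : coalgType F).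
Implicit Types (p q : dual C) (x : C).

(** The two actions of the dual algebra on [C], usually written with
    harpoons: [hitl p x] is [x_1 p(x_2)] and [hitr p x] is [p(x_1) x_2].  A
    subspace is a right coideal, or a subcomodule, exactly when it is closed
    under [hitl]; it is a subcoalgebra when it is closed under both. *)
Definition hitl p x : C := sw (fun a b => p b *: a) x.
Definition hitr p x : C := sw (fun a b => p a *: b) x.

Fact conv_linear p q : linear (fun x => sw (fun a b => p a * q b : F^o) x).
Proof. by lin. Qed.
Definition conv p q : dual C := mkdual (conv_linear p q).

Lemma convE p q x : conv p q x = sw (fun a b => p a * q b : F^o) x.
Proof. exact: mkdualE. Qed.

Lemma linear_hitl (U : lmodType F) p (f : U -> C) :
  linear f -> linear (fun u => hitl p (f u)).
Proof. exact: linear_sw. Qed.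

Lemma linear_hitr (U : lmodType F) p (f : U -> C) :
  linear f -> linear (fun u => hitr p (f u)).
Proof. exact: linear_sw. Qed.

Lemma linear_dapp_fun x : linear (fun p : dual C => p x : F^o).
Proof. by move=> k p q; rewrite dappD dappZ. Qed.

Lemma linear_hitl_fun x : linear (hitl^~ x).
Proof.
apply: linear_sw_fun => a b; apply: linear_scalel; exact: linear_dapp_fun.
Qed.

Lemma linear_hitr_fun x : linear (hitr^~ x).
Proof.
apply: linear_sw_fun => a b; apply: linear_scalel; exact: linear_dapp_fun.
Qed.

Lemma convEl p q x : conv p q x = p (hitl q x).
Proof.
rewrite convE sw_dapp; apply: eq_sws => a b.
by rewrite dappZr mulrC.
Qed.

Lemma convEr p q x : conv p q x = q (hitr p x).
Proof. by rewrite convE sw_dapp; apply: eq_sws => a b; rewrite dappZr. Qed.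

Lemma hitl_eps x : hitl (eps C) x = x.
Proof. by apply: (sw_epsr (f := id)). Qed.

Lemma hitr_eps x : hitr (eps C) x = x.
Proof. by apply: (sw_epsl (f := id)). Qed.

Lemma eps_hitl p x : eps C (hitl p x) = p x.
Proof.
rewrite sw_dapp -[RHS](sw_epsl (f := fun x => p x : F^o)); last by lin.
by apply: eq_sws => a b; rewrite dappZr mulrC.
Qed.

Lemma eps_hitr p x : eps C (hitr p x) = p x.
Proof.
rewrite sw_dapp -[RHS](sw_epsr (f := fun x => p x : F^o)); last by lin.
by apply: eq_sws => a b; rewrite dappZr mulrC.
Qed.

Lemma hitl_hitl p q x : hitl p (hitl q x) = hitl (conv p q) x.
Proof.
transitivity (sw (fun c d => sw (fun a b => q d *: (p b *: a)) c) x).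
  rewrite {2}/hitl sw_lin; last exact: linear_hitl.
  apply: eq_sw => c d; rewrite (linear_eqZ (f := hitl p)) ?sw_lin //.
    by lin.
  exact: linear_hitl.
rewrite sw_coassoc; [|by lin..].
apply: eq_sw => a b; rewrite convE (sw_lin (V := F^o) (f := fun k : F => k *: a)).
  by apply: eq_sw => c d; rewrite scalerA mulrC.
by lin.
Qed.

Lemma hitr_hitr p q x : hitr p (hitr q x) = hitr (conv q p) x.
Proof.
transitivity (sw (fun a b => sw (fun c d => q a *: (p c *: d)) b) x).
  rewrite {2}/hitr sw_lin; last exact: linear_hitr.
  apply: eq_sw => c d; rewrite (linear_eqZ (f := hitr p)) ?sw_lin //.
    by lin.
  exact: linear_hitr.
rewrite -sw_coassoc; [|by lin..].
apply: eq_sw => a b; rewrite convE (sw_lin (V := F^o) (f := fun k : F => k *: b)).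
  by apply: eq_sw => c d; rewrite scalerA.
by lin.
Qed.

Lemma hitl_hitr p q x : hitl p (hitr q x) = hitr q (hitl p x).
Proof.
transitivity (sw (fun a b => sw (fun c d => q a *: (p d *: c)) b) x).
  rewrite /hitr sw_lin; last exact: linear_hitl.
  apply: eq_sw => c d; rewrite (linear_eqZ (f := hitl p)) ?sw_lin //.
    by lin.
  exact: linear_hitl.
rewrite -sw_coassoc; [|by lin..].
rewrite /hitl sw_lin; last exact: linear_hitr.
apply: eq_sw => c d; rewrite (linear_eqZ (f := hitr q)) ?sw_lin //.
- by apply: eq_sw => a b; rewrite !scalerA mulrC.
- by lin.
exact: linear_hitr.
Qed.

Lemma convA p q r : conv p (conv q r) = conv (conv p q) r.
Proof. by apply: dual_ext => x; rewrite !convEl hitl_hitl. Qed.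

Lemma conv1p p : conv (eps C) p = p.
Proof. by apply: dual_ext => x; rewrite convEr hitr_eps. Qed.

Lemma convp1 p : conv p (eps C) = p.
Proof. by apply: dual_ext => x; rewrite convEl hitl_eps. Qed.

End Hits.
Arguments hitl {F C}.
Arguments hitr {F C}.
Arguments conv {F C}.
#[export] Hint Extern 2 (linear _) => apply: linear_hitl : lin.
#[export] Hint Extern 2 (linear _) => apply: linear_hitr : lin.

(** * The antipode *)

Section Antipode.
Variables (F : fieldType) (H : hopfAlgType F).
Implicit Types (V : vectType F) (x y : H).

Local Notation S := (@antipode F H).

Lemma sw_antipodel V (f : H -> V) x : linear f ->
  sw (fun a b => f (S a * b)) x = eps H x *: f 1.
Proof.
move=> lf; rewrite epsE -(linear_eqZ _ _ lf) -antipodel.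
by rewrite [in RHS](sw_lin _ _ lf).
Qed.

Lemma sw_antipoder V (f : H -> V) x : linear f ->
  sw (fun a b => f (a * S b)) x = eps H x *: f 1.
Proof.
move=> lf; rewrite epsE -(linear_eqZ _ _ lf) -antipoder.
by rewrite [in RHS](sw_lin _ _ lf).
Qed.

Lemma sw_grouplike V (b : H -> H -> V) g : is_grouplike g ->
  (forall y, linear (b^~ y)) -> (forall x, linear (b x)) -> sw b g = b g g.
Proof. by case/andP=> _ /eqP gg l1 l2; rewrite /sw gg tlift_pure. Qed.

Lemma swM V (b : H -> H -> V) x y :
  (forall y, linear (b^~ y)) -> (forall x, linear (b x)) ->
  sw b (x * y) = sw (fun a c => sw (fun d e => b (a * d) (c * e)) y) x.
Proof.
move=> l1 l2; rewrite /sw comulM; move: (comul x); apply: tensor_ext.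
- by lin.
- exact: linear_tlift.
move=> v w; rewrite tlift_pure; last 2 first.
- move=> u; apply: linear_tlift_fun => a c.
  by apply: (linear_comp (l1 _)); lin.
- move=> u; apply: linear_tlift_fun => a c.
  by apply: (linear_comp (l2 _)); lin.
move: (comul y); apply: tensor_ext.
- by apply: linear_tlift; lin.
- exact: linear_tlift.
move=> s t; rewrite tmul_pure !tlift_pure //.
- by move=> u; apply: (linear_comp (l1 _)); lin.
- by move=> u; apply: (linear_comp (l2 _)); lin.
Qed.

Lemma epsM x y : eps H (x * y) = eps H x * eps H y.
Proof. by rewrite !epsE counitM. Qed.

Lemma eps1 : eps H 1 = 1.
Proof. by rewrite epsE counit1. Qed.

Lemma antipode1 : S 1 = 1.
Proof. by have := antipode_grouplike_mull (is_grouplike1 H); rewrite mulr1. Qed.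

(** Both sides are convolution inverses of the product of [H]; the proof
    evaluates [S(y_1) S(x_1) x_2 y_2 S(x_3 y_3)] in two ways. *)
Lemma antipodeM x y : S (x * y) = S y * S x.
Proof.
pose k (a c e g f h : H) : H := S c * (S a * e) * g * S (f * h).
have -> : S y * S x = sw (fun a b => sw (fun c d =>
    sw (fun e f => sw (fun g h => k a c e g f h) d) b) y) x.
  rewrite -[LHS](sw_epsr (f := fun a => S y * S a)); last by lin.
  apply: eq_sw => a b.
  rewrite -(sw_epsr (f := fun c => eps H b *: (S c * S a))); last by lin.
  apply: eq_sw => c d.
  transitivity (sw (fun u v => S c * S a * (u * S v)) (b * d)).
    rewrite (sw_antipoder (f := fun z => S c * S a * z)); last by lin.
    by rewrite epsM mulr1 scalerA mulrC.
  rewrite swM; [|by lin..].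
  by apply: eq_sw => e f; apply: eq_sw => g h; rewrite /k !mulrA.
under eq_sw => a b do rewrite sw_swap.
have coy a e f : sw (fun c d => sw (fun g h => k a c e g f h) d) y =
    sw (fun d h => sw (fun c g => k a c e g f h) d) y.
  by rewrite -[LHS]sw_coassoc // /k; lin.
under eq_sw => a b do under eq_sw => e f do rewrite coy.
rewrite -(sw_coassoc (t := fun a e f =>
    sw (fun d h => sw (fun c g => k a c e g f h) d) y)); [|by rewrite /k; lin..].
symmetry.
transitivity (sw (fun b f => eps H b *: sw (fun d h => eps H d *: S (f * h)) y) x).
  apply: eq_sw => b f.
  rewrite (sw_antipodel
    (f := fun z => sw (fun d h =>
      sw (fun c g => S c * z * g * S (f * h)) d) y)); last by lin.
  congr (_ *: _); apply: eq_sw => d h.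
  under eq_sw => c g do rewrite mulr1.
  by rewrite (sw_antipodel (f := fun z => z * S (f * h))) ?mul1r //; lin.
rewrite (sw_epsl (f := fun f => sw (fun d h => eps H d *: S (f * h)) y));
  last by lin.
by rewrite (sw_epsl (f := fun h => S (x * h))) //; lin.
Qed.

Lemma antipode2_grouplike a : is_grouplike a -> S (S a) = a.
Proof.
move=> ga; rewrite -[LHS]mulr1 -(antipode_grouplike_mull ga) mulrA.
by rewrite (antipode_grouplike_mull (is_grouplikeV ga)) mul1r.
Qed.

Lemma tmulA (r s t : tensor H H) : tmul r (tmul s t) = tmul (tmul r s) t.
Proof.
move: t; apply: tensor_ext => [||v w]; [by lin..|].
move: s; apply: tensor_ext => [||v' w']; [by lin..|].
exact: tmulA_pure.
Qed.

Lemma tmul1l (t : tensor H H) : tmul (pure 1 1) t = t.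
Proof.
move: t; apply: tensor_ext => [||v w]; [by lin..|].
by rewrite tmul_pure !mul1r.
Qed.

Let tau x : tensor H H := sw (fun a b => pure (S b) (S a)) x.

Let comul_tau x : sw (fun a b => tmul (comul a) (tau b)) x = eps H x *: pure 1 1.
Proof.
pose k (a b c d : H) : tensor H H := pure (a * S d) (b * S c).
transitivity (sw (fun a d => sw (fun e f => sw (k e f) d) a) x).
  apply: eq_sw => a d; rewrite [comul a]tensor_decomp -/(sw _ a).
  rewrite (sw_lin (f := fun t => tmul t (tau d))); last by lin.
  apply: eq_sw => e f; rewrite (sw_lin (f := tmul (pure e f))); last by lin.
  by apply: eq_sw => g h; rewrite tmul_pure.
rewrite (sw_coassoc (t := fun e f d => sw (k e f) d)); [|by rewrite /k; lin..].
rewrite -(sw_antipoder (f := fun z => pure z 1)); last by lin.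
apply: eq_sw => e b; rewrite -sw_coassoc; [|by rewrite /k; lin..].
rewrite -(sw_epsl (f := fun h => pure (e * S h) 1)); last by lin.
apply: eq_sw => c h.
by rewrite (sw_antipoder (f := fun z => pure (e * S h) z)) //; lin.
Qed.

(** Both sides are convolution inverses of the coproduct: [tau] is one by
    [comul_tau], and the coproduct of [S] is one because the coproduct is
    multiplicative. *)
Lemma comul_antipode x : comul (S x) = sw (fun a b => pure (S b) (S a)) x.
Proof.
have lt : linear tau by apply: linear_sw.
transitivity (sw (fun a b => sw (fun c d =>
    tmul (comul (S a)) (tmul (comul c) (tau d))) b) x).
  rewrite -[LHS](sw_epsr (f := fun z => comul (S z))); last by lin.
  apply: eq_sw => a b.
  rewrite -(sw_lin (f := fun z => tmul (comul (S a)) z)); last by lin.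
  by rewrite comul_tau linear_eqZ ?tmul1_pure //; lin.
rewrite -sw_coassoc; last 3 first; [by lin..| |].
  by move=> a b; do 2!apply: linear_tmulr.
rewrite -[RHS](sw_epsl (f := tau)) //.
apply: eq_sw => a b.
under eq_sw => c d do rewrite tmulA -comulM.
rewrite (sw_antipodel (f := fun z => tmul (comul z) (tau b))); last by lin.
by rewrite comul1 tmul1l.
Qed.

End Antipode.

(** * Subcomodules of a pointed Hopf algebra *)

Section Separation.
Variables (F : fieldType) (V W : vectType F).

(** Subtracting the projection onto [U] reduces the separation of [x] from [U]
    to the separation of a nonzero vector from 0. *)
Lemma dual_sep_sub (U : {vspace V}) x : x \notin U ->
  exists2 psi : dual V, forall y, y \in U -> psi y = 0 & psi x != 0.
Proof.
move=> xU; have [p px] : exists p : dual V, p (x - projv U x) != 0.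
  apply: contrapT => np; case/negP: xU.
  suff /eqP : x - projv U x = 0.
    by rewrite subr_eq0 => /eqP ->; apply: memv_proj.
  apply: dual_sep => p; apply/eqP/negPn/negP => px; apply: np; by exists p.
have lp : linear (fun y => p (y - projv U y) : F^o).
  apply: linear_dapp => k u v; rewrite linearP scalerBr opprD !addrA.
  by congr (_ + _); rewrite addrAC.
exists (mkdual lp) => [y yU|]; rewrite mkdualE //.
by rewrite projv_id // subrr dapp0.
Qed.

Lemma tensor_sep (s t : tensor V W) :
  (forall (p : dual V) (q : dual W),
    tlift (fun a b => p a * q b : F^o) s =
    tlift (fun a b => p a * q b : F^o) t) -> s = t.
Proof.
have co i j : (fun r : tensor V W => (r : 'M_(_, _)) i j : F^o) =1
    tlift (fun a b => dcoord i a * dcoord j b : F^o).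
  apply: tensor_ext.
  - by move=> k u v; rewrite !mxE.
  - exact: tlift_linear.
  - by move=> v w; rewrite mxE tlift_pure ?dcoordE //; lin.
by move=> e; apply/matrixP => i j; have := e (dcoord i) (dcoord j); rewrite -!co.
Qed.

Lemma tspace_tlift (U : vectType F) (X : {vspace V}) (Y : {vspace W})
    (Z : {vspace U}) (b : V -> W -> U) t :
  (forall w, linear (b^~ w)) -> (forall v, linear (b v)) ->
  (forall x y, x \in X -> y \in Y -> b x y \in Z) ->
  t \in tspace X Y -> tlift b t \in Z.
Proof.
move=> l1 l2 bZ; rewrite -(mkhomE (tlift_linear b)) memv_preim.
apply: subvP; apply/span_subvP => _ /allpairsP[[x y] /= [xX yY ->]].
rewrite -memv_preim mkhomE tlift_pure //.
by apply: bZ; [apply: vbasis_mem xX|apply: vbasis_mem yY].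
Qed.

End Separation.

Section Subcomodule.
Variables (F : fieldType) (H : hopfAlgType F).
Implicit Types (U M : {vspace H}) (p q : dual H).

Definition subcomod U := forall p x, x \in U -> hitl p x \in U.

(** The coproduct of [x], expanded along a basis in its second factor, has the
    [hitl p x] as coefficients; this is how properties of the action [hitl]
    turn into properties of the coproduct. *)
Lemma sw_hitl (V : vectType F) (b : H -> H -> V) x :
  (forall y, linear (b^~ y)) -> (forall x, linear (b x)) ->
  sw b x = \sum_j b (hitl (dcoord j) x) (vbasis {:H})`_j.
Proof.
move=> l1 l2.
transitivity (sw (fun a c => \sum_j dcoord j c *: b a (vbasis {:H})`_j) x).
  apply: eq_sw => a c; rewrite [in LHS](vect_coordE c).
  rewrite -(mkhomE (l2 a)) linear_sum; apply: eq_bigr => j _.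
  by rewrite linearZ /= dcoordE mkhomE.
rewrite sw_sum; apply: eq_bigr => j _.
rewrite /hitl (sw_lin _ _ (l1 _)).
by apply: eq_sw => a c; rewrite (linear_eqZ _ _ (l1 _)).
Qed.

(** The coproduct maps a subcomodule [U] to the tensor product of [U] and [H].
    The projection to [U] makes this usable without a coaction. *)
Lemma sw_subcomod (V : vectType F) U (b : H -> H -> V) x :
  (forall y, linear (b^~ y)) -> (forall x, linear (b x)) ->
  subcomod U -> x \in U ->
  sw b x = sw (fun a c => b (vsval (vsproj U a)) c) x.
Proof.
move=> l1 l2 sU xU; rewrite !sw_hitl //.
- by apply: eq_bigr => j _; rewrite vsprojK //; apply: sU.
- move=> y; by apply: (linear_comp (l1 y)) => k u v; rewrite !linearP.
Qed.

Section Restrict.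
Variable U : {vspace H}.
Hypothesis sU : subcomod U.

Definition coactU_fun (v : subvs_of U) : tensor (subvs_of U) H :=
  sw (fun a b => pure (vsproj U a) b) (vsval v).

Fact coactU_linear : linear coactU_fun.
Proof. by apply: linear_sw => k u v; rewrite linearP. Qed.

Definition coactU : {linear subvs_of U -> tensor (subvs_of U) H} :=
  HB.pack coactU_fun
    (GRing.isLinear.Build F (subvs_of U) (tensor (subvs_of U) H) *:%R coactU_fun
      coactU_linear).

Let lproj : linear (vsproj U). Proof. exact: linearP. Qed.
Let lval : linear (@vsval _ _ U). Proof. exact: linearP. Qed.

Lemma coactUA v :
  tassoc (tmap coactU idfun (coactU v)) = tmap idfun comul (coactU v).
Proof.
have lc : linear coactU by exact: linearP.
rewrite /= /coactU_fun (sw_lin (f := tmap _ _)); last exact: linear_tlift.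
rewrite (sw_lin (f := tmap _ _)); last exact: linear_tlift.
rewrite (sw_lin (f := @tassoc _ _ _ _)); last exact: linear_tlift.
transitivity (sw (fun a b => sw (fun c d =>
  pure (vsproj U c) (pure d b)) a) (vsval v)).
  rewrite [RHS](sw_subcomod (U := U)) ?subvsP //; last 2 first.
  - by move=> y; apply: linear_sw.
  - by move=> y; apply: linear_sw_fun => c d; lin.
  apply: eq_sw => a b; rewrite /tmap tlift_pure; last 2 first.
  - by move=> w; apply: linear_purel.
  - by move=> w; apply: linear_purer.
  rewrite /tassoc tlift_pure; last 2 first.
  - by move=> w; apply: linear_tlift.
  - by move=> w; apply: linear_tlift_fun => c d; lin.
  rewrite /= /coactU_fun (sw_lin (f := tlift _)); last exact: linear_tlift.
  by apply: eq_sw => c d; rewrite tlift_pure //; lin.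
rewrite sw_coassoc; last 3 first.
- by move=> b c; apply: linear_purel.
- by lin.
- by lin.
apply: eq_sw => a b; rewrite /tmap tlift_pure; last 2 first.
- by lin.
- by lin.
rewrite [comul b in RHS]tensor_decomp -/(sw _ b) /=.
by rewrite [RHS](sw_lin (f := pure _)) //; lin.
Qed.

Lemma coactU1 v :
  tlift (fun (u : subvs_of U) (c : H) => counit c *: u) (coactU v) = v.
Proof.
rewrite /= /coactU_fun (sw_lin (f := tlift _)); last exact: linear_tlift.
rewrite -[RHS]vsvalK -[vsval v in RHS]hitl_eps /hitl (sw_lin _ _ lproj).
apply: eq_sw => a b; rewrite tlift_pure.
- by rewrite linearZ epsE.
- by lin.
- move=> u; apply: linear_scalel; exact: linearP.
Qed.

Definition subcomod_type : comodType H :=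
  HB.pack_for (comodType H) (subvs_of U)
    (isComodule.Build F H (subvs_of U) coactUA coactU1).

Hypothesis U0 : U != 0%VS.
Hypothesis minU : forall M, subcomod M -> (M <= U)%VS -> M != 0%VS -> M = U.

Let dim_sub : \dim {:subvs_of U} = \dim U.
Proof. by rewrite dimvf. Qed.

(** A subcomodule of [U] as an abstract comodule is the same as a subcomodule of
    [H] contained in [U]. *)
Lemma minimal_irreducible : irreducible_comod subcomod_type.
Proof.
split=> [|W sW].
  by rewrite [X in X != _]dim_sub dimv_eq0.
pose val' := mkhom lval; pose M := (val' @: (W : {vspace subvs_of U}))%VS.
have kv : lker val' == 0%VS.
  by apply/lker0P => x y; rewrite !mkhomE; apply: val_inj.
have sM : subcomod M.
  move=> p _ /memv_imgP[w wW ->]; rewrite mkhomE.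
  have bl (y : H) : linear (fun u : subvs_of U => p y *: u) by lin.
  have br (u : subvs_of U) : linear (fun y : H => p y *: u) by lin.
  have h : tlift (fun (u : subvs_of U) (y : H) => p y *: u) (coactU w)
      \in (W : {vspace subvs_of U}).
    apply: (tspace_tlift bl br (X := W) (Y := {:H})); last exact: sW.
    by move=> u y uW _; apply: memvZ.
  suff e : tlift (fun (u : subvs_of U) (y : H) => p y *: u) (coactU w) =
      vsproj U (hitl p (vsval w)).
    rewrite e in h; rewrite -[hitl _ _](@vsprojK _ _ U) ?sU ?subvsP //.
    by rewrite -[vsval _](mkhomE lval) memv_img.
  rewrite /= /coactU_fun (sw_lin (f := tlift _)); last exact: linear_tlift.
  rewrite /hitl (sw_lin _ _ lproj); apply: eq_sw => a b.
  by rewrite tlift_pure // linearZ.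
have MU : (M <= U)%VS.
  by apply/subvP => _ /memv_imgP[w _ ->]; rewrite mkhomE subvsP.
have [W0|W0] := eqVneq W 0%VS; [by left|right].
have dM : \dim M = \dim W by rewrite limg_dim_eq // (eqP kv) capv0.
apply/eqP; rewrite eqEdim subvf /= [X in (X <= _)%N]dim_sub.
by rewrite -(minU sM MU) ?dM // -dimv_eq0 dM dimv_eq0.
Qed.

Lemma minimal_dim1 : pointed_coalg H -> \dim U = 1%N.
Proof. by move/(_ subcomod_type minimal_irreducible) => <-; rewrite -dim_sub. Qed.

End Restrict.
End Subcomodule.

(** * Nilpotency of the annihilator of the grouplike elements *)

Section Nilpotency.
Variables (F : fieldType) (H : hopfAlgType F).
Hypothesis pt : pointed_coalg H.
Implicit Types (U M : {vspace H}) (p q : dual H).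

Lemma comul_sep (x : H) (t : tensor H H) :
  (forall p q : dual H, conv p q x = tlift (fun a b => p a * q b : F^o) t) ->
  comul x = t.
Proof. by move=> e; apply: tensor_sep => p q; rewrite -e convE. Qed.

Lemma hitl_grouplike p a : is_grouplike a -> hitl p a = p a *: a.
Proof. by move=> ga; rewrite /hitl sw_grouplike //; lin. Qed.

Lemma hitr_grouplike p a : is_grouplike a -> hitr p a = p a *: a.
Proof. by move=> ga; rewrite /hitr sw_grouplike //; lin. Qed.

Lemma dual_neq0 (x : H) : x != 0 -> exists p : dual H, p x = 1.
Proof.
move=> x0; have [|p _ px] := @dual_sep_sub _ _ 0%VS x; first by rewrite memv0.
by exists ((p x)^-1 *: p); rewrite dappZ mulVf.
Qed.

(** The coproduct of such a [u] is [u (x) a].  The counit shows that [u] is a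
    multiple of [a], and then coassociativity that [a] is grouplike. *)
Lemma eigenvector_grouplike (u a : H) : u != 0 ->
  (forall p, hitl p u = p a *: u) -> is_grouplike a /\ u = eps H u *: a.
Proof.
move=> u0 ua; have ue : u = eps H u *: a.
  apply/eqP; rewrite -subr_eq0; apply/eqP/dual_sep => p.
  by rewrite dappBr dappZr -(eps_hitl p u) ua dappZr mulrC subrr.
have eu : eps H u != 0.
  by apply: contraNneq u0 => e0; rewrite ue e0 scale0r.
split=> //; apply/andP; split.
  by apply: contraNneq u0 => a0; rewrite ue a0 scaler0.
apply/eqP/comul_sep => p q; rewrite tlift_pure; [|by lin..].
rewrite convEl; apply: (mulfI eu); rewrite -dappZr.
rewrite -(linear_eqZ (f := hitl q)); last by lin.
by rewrite -ue ua dappZr [in LHS]ue dappZr mulrCA [q a * _]mulrC.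
Qed.

(** Such a [U] is an irreducible comodule, hence a line, and a vector spanning
    it is an eigenvector of every [hitl p]. *)
Lemma minimal_grouplike U : subcomod U -> U != 0%VS ->
  (forall M, subcomod M -> (M <= U)%VS -> M != 0%VS -> M = U) ->
  exists2 a, is_grouplike a & U = <[a]>%VS.
Proof.
move=> sU U0 minU; have U1 := minimal_dim1 sU U0 minU pt.
have uU := memv_pick U; set u := vpick U in uU.
have u0 : u != 0 by rewrite vpick0.
have Uu : U = <[u]>%VS.
  by apply/esym/eqP; rewrite eqEdim -memvE uU U1 dim_vline u0.
have [phi pu] := dual_neq0 u0.
have [||ga ue] := @eigenvector_grouplike u (hitr phi u) => //.
  move=> p; have := sU p u uU; rewrite Uu => /vlineP[k e].
  by rewrite -convEr convEl e dappZr pu mulr1.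
exists (hitr phi u) => //; apply/eqP; rewrite eqEdim dim_vline U1 leq_b1 andbT.
by rewrite Uu -memvE [X in X \in _]ue memvZ ?memv_line.
Qed.

Lemma hom_image_subcomod phi M (f : 'End(H)) : (forall x, f x = hitr phi x) ->
  subcomod M -> subcomod (f @: M)%VS.
Proof.
move=> fE sM p _ /memv_imgP[x xM ->].
by rewrite fE hitl_hitr -fE memv_img ?sM.
Qed.

(** Among the nonzero images of [M] under the comodule endomorphisms [hitr phi]
    of [H], one of least dimension is simple: given a proper nonzero subcomodule
    [N] of it, a functional [psi] that vanishes on [N] but not on the image
    yields the smaller nonzero image under [hitr psi].  Working with images
    inside [H] avoids quotient comodules. *)
Lemma subcomod_head M : subcomod M -> M != 0%VS ->
  exists phi a, [/\ is_grouplike a,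
    forall x, x \in M -> hitr phi x \in <[a]>%VS &
    exists2 x, x \in M & hitr phi x != 0].
Proof.
move=> sM M0.
pose h (phi : dual H) : 'End(H) := mkhom (linear_hitr phi (@linear_id F H)).
have hE phi x : h phi x = hitr phi x by rewrite mkhomE.
pose P n := `[< exists2 phi, (h phi @: M)%VS != 0%VS & \dim (h phi @: M) = n >].
have exP : exists n, P n.
  exists (\dim M); apply/asboolP; exists (eps H).
    rewrite [X in X != _](_ : _ = M) //.
    by rewrite -[RHS]lim1g; apply: eq_in_limg => x _; rewrite hE hitr_eps lfunE.
  congr (\dim _).
  by rewrite -[RHS]lim1g; apply: eq_in_limg => x _; rewrite hE hitr_eps lfunE.
case: (ex_minnP exP) => n /asboolP[phi hM0 dimh] minn.
have [|//||a ga Ua] := @minimal_grouplike (h phi @: M)%VS.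
- exact: hom_image_subcomod (hE phi) sM.
- move=> N sN NU N0; apply/eqP/negPn/negP => NnU.
  have [x xM xN] : exists2 x, x \in (h phi @: M)%VS & x \notin N.
    apply: contrapT => nx; case/negP: NnU; rewrite eqEsubv NU /=.
    by apply/subvP => x xM; apply/negPn/negP => xN; apply: nx; exists x.
  have [psi psiN psix] := dual_sep_sub xN.
  have e : (h psi @: (h phi @: M))%VS = (h (conv phi psi) @: M)%VS.
    rewrite -limg_comp; apply: eq_in_limg => y _.
    by rewrite lfunE /= !hE hitr_hitr.
  have nz : (h psi @: (h phi @: M))%VS != 0%VS.
    apply: contraNneq psix => z; apply/eqP.
    have := memv_img (h psi) xM; rewrite z memv0 hE => /eqP r0.
    by rewrite -eps_hitr r0 dapp0.
  have Pn : P (\dim (h psi @: (h phi @: M))).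
    by apply/asboolP; exists (conv phi psi); rewrite -e.
  have := minn _ Pn; rewrite leqNgt => /negP; apply.
  rewrite -dimh -[X in (_ < X)%N](limg_ker_dim (h psi)) -[X in (X < _)%N]add0n.
  rewrite ltn_add2r lt0n dimv_eq0; apply: contraNneq N0 => z.
  rewrite -subv0 -z subv_cap NU /=; apply/subvP => y yN.
  rewrite memv_ker hE; apply/eqP/dual_sep => p.
  by rewrite -convEr convEl psiN // sN.
exists phi, a; split=> // [x xM|]; first by rewrite -Ua -hE memv_img.
apply: contrapT => nx; case/negP: hM0; rewrite -subv0.
apply/subvP => _ /memv_imgP[x xM ->]; rewrite memv0 hE; apply/negPn/negP => r0.
by apply: nx; exists x.
Qed.

(** The annihilator of the grouplike elements; for pointed [H], this is the
    Jacobson radical of the dual algebra. *)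
Definition glann p := forall a, is_grouplike a -> p a = 0.

Lemma foldr_hitl ps x : foldr hitl x ps = hitl (foldr conv (eps H) ps) x.
Proof. by elim: ps => [|p ps IH] /=; rewrite ?hitl_eps // IH hitl_hitl. Qed.

(** Each functional in the annihilator maps [M] into the kernel of a nonzero
    comodule map from [M] to a line spanned by a grouplike element, and this
    kernel is a smaller subcomodule. *)
Lemma hitl_nilpotent_sub k M ps x : subcomod M -> (\dim M <= k)%N ->
  size ps = k -> {in ps, forall p, glann p} -> x \in M -> foldr hitl x ps = 0.
Proof.
elim: k M ps x => [|k IH] M ps x sM dM sz Jps xM.
  move: dM; rewrite leqn0 dimv_eq0 => /eqP M0.
  by move: xM; rewrite (size0nil sz) M0 memv0 => /eqP.
have [M0|M0] := eqVneq M 0%VS.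
  move: xM; rewrite M0 memv0 => /eqP ->.
  by rewrite foldr_hitl (linear_eq0 (linear_hitl _ (@linear_id _ _))).
case/lastP: ps => [//|ps p] in sz Jps *.
rewrite size_rcons in sz; case: sz => sz; rewrite foldr_rcons.
have [phi [a [ga Ma [y yM ry]]]] := subcomod_head sM M0.
pose h : 'End(H) := mkhom (linear_hitr phi (@linear_id F H)).
have hE z : h z = hitr phi z by rewrite mkhomE.
apply: (IH (M :&: lker h)%VS) => //.
- move=> q z; rewrite !memv_cap !memv_ker !hE => /andP[zM /eqP z0].
  by rewrite sM //= -hitl_hitr z0 (linear_eq0 (linear_hitl _ (@linear_id _ _))).
- rewrite -ltnS (leq_trans _ dM) // -[X in (_ < X)%N](limg_ker_dim h).
  rewrite -[X in (X < _)%N]addn0 ltn_add2l lt0n dimv_eq0.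
  apply: contraNneq ry => z; have := memv_img h yM.
  by rewrite z memv0 hE.
- by move=> q qps; apply: Jps; rewrite mem_rcons inE qps orbT.
rewrite memv_cap sM //= memv_ker hE -hitl_hitr.
have /vlineP[c ->] := Ma x xM.
rewrite (linear_eqZ (f := hitl p)); last by lin.
by rewrite hitl_grouplike // Jps ?mem_rcons ?inE ?eqxx // scale0r scaler0.
Qed.

Lemma glann_nilpotent ps : size ps = \dim {:H} ->
  {in ps, forall p, glann p} -> foldr conv (eps H) ps = 0.
Proof.
move=> sz Jps; apply: dual_ext => x; rewrite dapp0l -eps_hitl -foldr_hitl.
rewrite (@hitl_nilpotent_sub (\dim {:H}) {:H}) ?dapp0 ?memvf // => p z _.
exact: memvf.
Qed.

(** Here [T] is a representation of the dual algebra or of its opposite; the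
    condition on [r] covers both cases, since [r] is then determined up to the
    annihilator of the grouplike elements.  The subquotient of [V] with
    numerator [U] and denominator [C] contains a vector killed by this
    annihilator, because products of [n] of its elements act as zero.  The
    functionals [e i] dual to the grouplike elements are orthogonal idempotents
    with sum 1 modulo the annihilator, and one of them maps that vector to an
    eigenvector outside [C]. *)
Lemma socle_eigenvector (V : vectType F) (T : dual H -> V -> V) (U : V -> Prop)
    (C : {vspace V}) (n : nat) :
  (forall v, linear (T^~ v)) -> (forall v, T (eps H) v = v) ->
  (forall p q, exists2 r, forall v, T p (T q v) = T r v &
     forall a, is_grouplike a -> r a = p a * q a) ->
  (forall p v, v \in C -> T p v \in C) -> (forall p v, U v -> U (T p v)) ->
  (forall ps v, size ps = n -> {in ps, forall p, glann p} -> foldr T v ps = 0) ->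
  (exists2 v, U v & v \notin C) ->
  exists a v, [/\ is_grouplike a, U v, v \notin C &
    forall q, T q v - q a *: v \in C].
Proof.
move=> lT T1 TM TC TU Tn exv.
have [v [Uv vC] Jv] : exists2 v, U v /\ v \notin C &
    forall p, glann p -> T p v \in C.
  apply: contrapT => nv; case: exv => v Uv vC.
  have {Tn}: forall ps, size ps = n -> {in ps, forall p, glann p} ->
      foldr T v ps \in C by move=> ps sz Jps; rewrite Tn ?mem0v.
  elim: n v Uv vC => [|n IH] v Uv vC; first by move/(_ [::] erefl) => h;
    case/negP: vC; apply: h.
  move=> h; apply: nv; exists v => // p Jp; apply/negPn/negP => pC.
  apply: IH (TU p v Uv) pC _ => ps sz Jps.
  rewrite -foldr_rcons; apply: h; first by rewrite size_rcons sz.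
  by move=> q; rewrite mem_rcons inE => /predU1P[->|/Jps].
have [s [Us gs fs]] : exists s : seq H, [/\ uniq s,
    {in s, forall a, is_grouplike a} & forall a, is_grouplike a -> a \in s].
  have [s hs] := grouplike_fin H; exists (undup (filter (@is_grouplike F H) s)).
  split=> [|a|a ga]; rewrite ?undup_uniq // mem_undup mem_filter.
    by case/andP.
  by rewrite ga hs.
have free_s : free (in_tuple s) by exact: grouplike_free.
have lc i : linear (coord (in_tuple s) i : H -> F^o) by exact: linearP.
pose e i : dual H := mkdual (lc i).
have eE i (j : 'I_(size s)) : e i s`_j = (j == i)%:R.
  by rewrite mkdualE (coord_free _ _ free_s).
have annP p : (forall i : 'I_(size s), p s`_i = 0) -> glann p.
  move=> ps a ga; have as_ := fs a ga.
  have lt : (index a s < size s)%N by rewrite index_mem.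
  by have := ps (Ordinal lt); rewrite /= nth_index.
have TD p q w : T (p + q) w = T p w + T q w.
  by have := lT w 1 p q; rewrite !scale1r.
have [i eiC] : exists i, T (e i) v \notin C.
  apply: contrapT => ne; case/negP: (vC); rewrite -[v]T1.
  rewrite -[eps H](subrK (\sum_i e i)) TD; apply: memvD.
    apply: Jv; apply: annP => j; rewrite dappB dapp_sum (bigD1 j) //= eE eqxx.
    rewrite big1 => [|k kj]; last by rewrite eE eq_sym (negPf kj).
    by rewrite epsE counit_grouplike ?gs ?mem_nth // addr0 subrr.
  rewrite (big_morph (T^~ v) (fun p q => TD p q v) (linear_eq0 (lT v))).
  apply: memv_suml => k _.
  by apply/negPn/negP => h; apply: ne; exists k.
exists s`_i, (T (e i) v); split=> [|||q]; [|exact: TU|by []|].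
  by apply/gs/mem_nth.
have [r TE rE] := TM q (e i).
have -> : T q (T (e i) v) - q s`_i *: T (e i) v = T (r - q s`_i *: e i) v.
  by rewrite TE addrC -scaleNr -lT scaleNr addrC.
apply: Jv; apply: annP => j; rewrite dappB dappZ rE ?eE; last by apply/gs/mem_nth.
by case: eqP => [->|_]; rewrite ?subrr // !mulr0 subrr.
Qed.

End Nilpotency.

(** * Integrals *)

Section Socles.
Variables (F : fieldType) (H : hopfAlgType F).
Hypothesis pt : pointed_coalg H.
Implicit Types (p q : dual H).

Lemma conv_grouplike p q a : is_grouplike a -> conv p q a = p a * q a.
Proof. by move=> ga; rewrite convEr hitr_grouplike // dappZr. Qed.

Lemma foldr_hitr ps (x : H) :
  foldr hitr x ps = hitr (foldr conv (eps H) (rev ps)) x.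
Proof.
elim: ps => [|p ps IH] /=; first by rewrite hitr_eps.
rewrite rev_cons foldr_rcons IH hitr_hitr; congr (hitr _ x).
rewrite convp1; elim: (rev ps) => [|q qs IHq] /=; first by rewrite conv1p.
by rewrite -convA IHq.
Qed.

Lemma foldr_conv ps (f : dual H) :
  foldr conv f ps = conv (foldr conv (eps H) ps) f.
Proof. by elim: ps => [|p ps IH] /=; rewrite ?conv1p // IH convA. Qed.

Lemma linear_conv_fun (f : dual H) : linear (conv^~ f).
Proof.
move=> k p q; apply: dual_ext => x.
by rewrite dappD dappZ !convEl dappD dappZ.
Qed.

Lemma socle_hitl (U : H -> Prop) (C : {vspace H}) :
  (forall p x, x \in C -> hitl p x \in C) -> (forall p x, U x -> U (hitl p x)) ->
  (exists2 x, U x & x \notin C) ->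
  exists a x, [/\ is_grouplike a, U x, x \notin C &
    forall q, hitl q x - q a *: x \in C].
Proof.
move=> sC sU exU; apply: (@socle_eigenvector _ H H hitl U C (\dim {:H})) => //.
- exact: linear_hitl_fun.
- exact: hitl_eps.
- move=> p q; exists (conv p q) => [x|a]; [exact: hitl_hitl|exact: conv_grouplike].
- move=> ps x sz Jps; rewrite foldr_hitl glann_nilpotent //.
  exact: (linear_eq0 (linear_hitl_fun x)).
Qed.

(** A nonzero subcomodule contains a grouplike element: its socle is spanned by
    eigenvectors, which are multiples of grouplike elements. *)
Lemma hitl_closed_eq0 (U : H -> Prop) : (forall p x, U x -> U (hitl p x)) ->
  (forall k x, U x -> U (k *: x)) -> (forall a, is_grouplike a -> ~ U a) ->
  forall x, U x -> x = 0.
Proof.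
move=> sU sZ Ua x Ux; apply/eqP/negPn/negP => x0.
have [|//||a [y [ga Uy y0 ya]]] := @socle_hitl U 0%VS.
- move=> p z; rewrite !memv0 => /eqP ->.
  by rewrite (linear_eq0 (linear_hitl p (@linear_id _ _))).
- by exists x; rewrite ?memv0.
rewrite memv0 in y0.
have [|_ ye] := @eigenvector_grouplike _ _ y a y0.
  by move=> p; apply/eqP; rewrite -subr_eq0 -memv0.
apply: (Ua a ga); have e0 : eps H y != 0.
  by apply: contraNneq y0 => e0; rewrite ye e0 scale0r.
by rewrite -[a]scale1r -(mulVf e0) -scalerA -ye; apply: sZ.
Qed.

Lemma socle_hitr (U : H -> Prop) (C : {vspace H}) :
  (forall p x, x \in C -> hitr p x \in C) -> (forall p x, U x -> U (hitr p x)) ->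
  (exists2 x, U x & x \notin C) ->
  exists a x, [/\ is_grouplike a, U x, x \notin C &
    forall q, hitr q x - q a *: x \in C].
Proof.
move=> sC sU exU; apply: (@socle_eigenvector _ H H hitr U C (\dim {:H})) => //.
- exact: linear_hitr_fun.
- exact: hitr_eps.
- move=> p q; exists (conv q p) => [x|a ga]; first exact: hitr_hitr.
  by rewrite conv_grouplike // mulrC.
- move=> ps x sz Jps; rewrite foldr_hitr glann_nilpotent ?size_rev //.
    exact: (linear_eq0 (linear_hitr_fun x)).
  by move=> p; rewrite mem_rev; apply: Jps.
Qed.

Lemma eps_neq0 : eps H != 0.
Proof. by apply: contra_neq (oner_neq0 F) => e; rewrite -(eps1 H) e dapp0l. Qed.

Lemma socle_conv : exists a (f : dual H), [/\ is_grouplike a, f != 0 &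
  forall q, conv q f = q a *: f].
Proof.
have [|||||||a [f [ga _ f0 fa]]] :=
    @socle_eigenvector _ H _ (fun p f => conv p f) (fun _ => True) 0%VS (\dim {:H}).
- exact: linear_conv_fun.
- exact: conv1p.
- move=> p q; exists (conv p q) => [f|a]; [exact: convA|exact: conv_grouplike].
- move=> p f; rewrite !memv0 => /eqP ->; apply/eqP/dual_ext => x.
  by rewrite convEr !dapp0l.
- by [].
- move=> ps f sz Jps; rewrite foldr_conv glann_nilpotent //.
  exact: (linear_eq0 (linear_conv_fun f)).
- by exists (eps H); rewrite // memv0 eps_neq0.
exists a, f; split; rewrite -?memv0 // => q; apply/eqP.
by rewrite -subr_eq0 -memv0.
Qed.

(** An eigenvector [f] of the dual algebra acting on itself has some grouplike
    element [a] as its eigenvalue; translating it by [a] moves the eigenvalue to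
    1, which is the condition to be an integral. *)
Lemma integral_exists : exists2 lam : dual H,
  lam != 0 & forall x, hitl lam x = lam x *: 1.
Proof.
have [a [f [ga f0 fa]]] := socle_conv.
have l : linear (fun x => f (a * x) : F^o) by lin.
have Sa x : antipode a * (a * x) = x.
  by rewrite mulrA antipode_grouplike_mull ?mul1r.
have aS x : a * (antipode a * x) = x.
  by rewrite mulrA antipode_grouplike_mulr ?mul1r.
exists (mkdual l) => [|x].
  apply: contraNneq f0 => l0; apply/eqP/dual_ext => x.
  by rewrite -(aS x) -(mkdualE l) l0 !dapp0l.
apply/eqP; rewrite -subr_eq0; apply/eqP/dual_sep => p.
have lp : linear (fun x => p (antipode a * x) : F^o) by lin.
have := fa (mkdual lp) => /(congr1 (fun h : dual H => h (a * x))).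
rewrite dappBr dappZr mkdualE dappZ mkdualE antipode_grouplike_mull //.
rewrite convE swM ?(sw_grouplike ga); try by lin.
rewrite -convEl convE => e; apply/eqP; rewrite subr_eq0 mulrC -e.
apply/eqP/eq_sws => u v.
by rewrite !mkdualE Sa.
Qed.

End Socles.

(** * Radford's formula *)

Section HitMul.
Variables (F : fieldType) (H : hopfAlgType F).

Lemma linear_surj (V W : vectType F) (f : V -> W) : linear f ->
  \dim {:V} = \dim {:W} -> (forall x, f x = 0 -> x = 0) ->
  forall y, exists x, f x = y.
Proof.
move=> lf dVW inj y; have k0 : lker (mkhom lf) == 0%VS.
  rewrite -subv0; apply/subvP => x; rewrite memv_ker mkhomE memv0 => /eqP.
  by move/inj => ->.
have im : limg (mkhom lf) = fullv.
  by apply/eqP; rewrite eqEdim subvf -dVW /= limg_dim_eq // (eqP k0) capv0.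
have : y \in limg (mkhom lf) by rewrite im memvf.
by case/memv_imgP => x _ ->; exists x; rewrite mkhomE.
Qed.

Lemma sw_antipode (V : vectType F) (b : H -> H -> V) x :
  (forall y, linear (b^~ y)) -> (forall x, linear (b x)) ->
  sw b (antipode x) = sw (fun a c => b (antipode c) (antipode a)) x.
Proof.
move=> l1 l2; rewrite {1}/sw comul_antipode (sw_lin (f := tlift b)).
  by apply: eq_sw => a c; rewrite tlift_pure.
exact: tlift_linear.
Qed.

Lemma hitl_mul (lam : dual H) x y : hitl lam (x * y) =
  sw (fun a b => sw (fun c d => lam (b * d) *: (a * c)) y) x.
Proof. by rewrite /hitl swM; lin. Qed.

Lemma hitr_mul (lam : dual H) x y : hitr lam (x * y) =
  sw (fun a b => sw (fun c d => lam (a * c) *: (b * d)) y) x.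
Proof. by rewrite /hitr swM; lin. Qed.
End HitMul.

Section Radford.
Variables (F : fieldType) (H : hopfAlgType F).
Hypothesis pt : pointed_coalg H.
Implicit Types (p q : dual H) (x y h : H).

Local Notation S := (@antipode F H).

Section Integral.
Variable lam : dual H.
Hypothesis lam0 : lam != 0.
Hypothesis lamI : forall x, hitl lam x = lam x *: 1.

(** That is, [y_1 lam(x y_2) = S(x_1) lam(x_2 y)]: write the left side as
    [S(x_1) x_2 y_1 lam(x_3 y_2)] and apply the integral property to
    [x_2 y]. *)
Lemma integral_swap x y :
  sw (fun a b => lam (x * b) *: a) y = sw (fun a b => lam (b * y) *: S a) x.
Proof.
pose k a c d e f : H := lam (d * f) *: (S a * c * e).
transitivity (sw (fun b d => sw (fun a c => sw (fun e f => k a c d e f) y) b) x).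
  rewrite -(sw_epsl (f := fun d => sw (fun e f => lam (d * f) *: e) y));
    last by lin.
  apply: eq_sw => b d.
  rewrite (sw_antipodel (f := fun z => sw (fun e f => lam (d * f) *: (z * e)) y)).
    by congr (_ *: _); apply: eq_sw => e f; rewrite mul1r.
  by lin.
rewrite (sw_coassoc (t := fun a c d => sw (fun e f => k a c d e f) y));
  [|by rewrite /k; lin..].
apply: eq_sw => a b.
transitivity (S a * hitl lam (b * y)).
  rewrite hitl_mul (sw_lin (f := fun z => S a * z)); last by lin.
  apply: eq_sw => c d; rewrite (sw_lin (f := fun z => S a * z)); last by lin.
  by apply: eq_sw => e f; rewrite /k -mulrA -scalerAr.
by rewrite lamI -scalerAr mulr1.
Qed.

(** That is, [x_1 lam(x_2 S(h)) = lam(x S(h_1)) h_2]: write the left side as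
    [x_1 S(h_2) h_3 lam(x_2 S(h_1))] and apply the integral property to
    [x S(h_1)]. *)
Lemma integral_antipode x h :
  sw (fun a b => lam (b * S h) *: a) x = sw (fun c d => lam (x * S c) *: d) h.
Proof.
pose k a b c e d : H := lam (b * S c) *: (a * (S e * d)).
transitivity (sw (fun a b => sw (fun c f => sw (fun e d => k a b c e d) f) h) x).
  apply: eq_sw => a b.
  rewrite -(sw_epsr (f := fun c => lam (b * S c) *: a)); last by lin.
  apply: eq_sw => c f.
  rewrite (sw_antipodel (f := fun z => lam (b * S c) *: (a * z))); last by lin.
  by rewrite mulr1.
rewrite sw_swap; under eq_sw => c f do rewrite sw_swap.
rewrite -(sw_coassoc (t := fun c e d => sw (fun a b => k a b c e d) x));
  [|by rewrite /k; lin..].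
apply: eq_sw => u d; rewrite -sw_swap.
transitivity (hitl lam (x * S u) * d); last by rewrite lamI -scalerAl mul1r.
rewrite hitl_mul (sw_lin (f := fun z => z * d)); last by lin.
apply: eq_sw => a b; rewrite (sw_lin (f := fun z => z * d)); last by lin.
rewrite sw_antipode; [|by lin..].
by apply: eq_sw => c e; rewrite /k -scalerAl mulrA.
Qed.

(** By [integral_antipode] the elements [h] in question form a subcomodule; a
    grouplike element [a] cannot belong to it, as [S a] is invertible. *)
Lemma integral_antipode_inj h : (forall x, lam (x * S h) = 0) -> h = 0.
Proof.
apply: (hitl_closed_eq0 pt (U := fun h => forall x, lam (x * S h) = 0)) => {h}.
- move=> p h h0 x; rewrite /hitl.
  rewrite (sw_lin (f := fun h => lam (x * S h) : F^o)); last by lin.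
  transitivity (p (sw (fun c d => lam (x * S c) *: d) h)).
    rewrite sw_dapp; apply: eq_sws => c d.
    by rewrite linearZ /= -scalerAr !dappZr mulrC.
  rewrite -integral_antipode -[RHS](dapp0 p); congr (p _).
  rewrite /sw /tlift big1 // => i _; rewrite big1 // => j _.
  by rewrite h0 scale0r scaler0.
- by move=> k h h0 x; rewrite linearZ -scalerAr dappZr h0 mulr0.
move=> a ga a0; case/negP: lam0; apply/eqP/dual_ext => x.
rewrite dapp0l -(a0 (x * a)) -mulrA.
by rewrite antipode_grouplike_mulr ?mulr1.
Qed.

Lemma antipode_inj h : S h = 0 -> h = 0.
Proof.
by move=> Sh; apply: integral_antipode_inj => x; rewrite Sh mulr0 dapp0.
Qed.

Lemma antipode_surj h : exists y, S y = h.
Proof.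
apply: (linear_surj (f := S)) => //; [exact: linearP|exact: antipode_inj].
Qed.

Lemma integral_ndr h : (forall x, lam (x * h) = 0) -> h = 0.
Proof.
have [y <-] := antipode_surj h => l0.
by rewrite (integral_antipode_inj l0) linear0.
Qed.

Lemma integral_ndrE h h' : (forall x, lam (x * h) = lam (x * h')) -> h = h'.
Proof.
move=> e; apply/eqP; rewrite -subr_eq0; apply/eqP/integral_ndr => x.
by rewrite mulrBr dappBr e subrr.
Qed.

(** The injective map that sends [h] to [lam(- h)] is onto, since [H] and its
    dual have the same dimension. *)
Lemma integral_repr p : exists h, forall x, p x = lam (x * h).
Proof.
have l h : linear (fun x => lam (x * h) : F^o) by lin.
have [|||h hE] := @linear_surj _ H (dual H) (fun h => mkdual (l h)) _ _ _ p.
- move=> k u v; apply: dual_ext => x.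
  by rewrite dappD dappZ !mkdualE mulrDr -scalerAr dappDr dappZr.
- by rewrite dual_dim.
- move=> h /(congr1 (fun q : dual H => dapp q)) h0; apply: integral_ndr => x.
  by have := congr1 (@^~ x) h0; rewrite /= mkdualE dapp0l.
by exists h => x; rewrite -hE mkdualE.
Qed.

Lemma integral_ndl h : (forall x, lam (h * x) = 0) -> h = 0.
Proof.
move=> h0; apply: dual_sep => p; have [x xE] := integral_repr p.
by rewrite xE h0.
Qed.

Lemma integral_ndlE h h' : (forall x, lam (h * x) = lam (h' * x)) -> h = h'.
Proof.
move=> e; apply/eqP; rewrite -subr_eq0; apply/eqP/integral_ndl => x.
by rewrite mulrBl dappBr e subrr.
Qed.

Lemma integral_reprl p : exists h, forall x, p x = lam (h * x).
Proof.
have l h : linear (fun x => lam (h * x) : F^o) by lin.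
have [|||h hE] := @linear_surj _ H (dual H) (fun h => mkdual (l h)) _ _ _ p.
- move=> k u v; apply: dual_ext => x.
  by rewrite dappD dappZ !mkdualE mulrDl -scalerAl dappDr dappZr.
- by rewrite dual_dim.
- move=> h /(congr1 (fun q : dual H => dapp q)) h0; apply: integral_ndl => x.
  by have := congr1 (@^~ x) h0; rewrite /= mkdualE dapp0l.
by exists h => x; rewrite -hE mkdualE.
Qed.

(** Write [mu = lam(h -)].  By [integral_swap] and nondegeneracy, the integral
    property of [mu] amounts to [S(h_1) (x) h_2 = 1 (x) h], so [S h] is scalar
    and hence [h] is. *)
Lemma integral_unique (mu : dual H) : (forall x, hitl mu x = mu x *: 1) ->
  exists k, mu = k *: lam.
Proof.
move=> muI; have [h hE] := integral_reprl mu.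
suff -> : mu = eps H h *: lam by exists (eps H h).
have lS p : linear (fun x => p (S x) : F^o) by lin.
have Sh p : hitr (mkdual (lS p)) h = p 1 *: h.
  apply: integral_ndlE => y; rewrite -scalerAl dappZr -hE.
  rewrite -[RHS]mulrC -dappZr -muI.
  transitivity (p (sw (fun a b => lam (b * y) *: S a) h)).
    rewrite /hitr (sw_lin (f := fun z => lam (z * y) : F^o)); last by lin.
    rewrite sw_dapp; apply: eq_sws => a b.
    by rewrite -scalerAl !dappZr mkdualE mulrC.
  rewrite -integral_swap; congr (p _).
  by apply: eq_sw => a b; rewrite hE.
have hh : h = eps H h *: 1.
  apply/eqP; rewrite -subr_eq0; apply/eqP/antipode_inj.
  rewrite linearB linearZ /= antipode1; apply/dual_sep => p.
  have := congr1 (eps H) (Sh p); rewrite eps_hitr mkdualE dappZr => e.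
  by rewrite dappBr dappZr e mulrC subrr.
apply: dual_ext => x; by rewrite dappZ hE {1}hh -scalerAl mul1r dappZr.
Qed.

End Integral.
End Radford.

Section Formula.
Variables (F : fieldType) (H : hopfAlgType F).
Hypothesis pt : pointed_coalg H.
Implicit Types (p q : dual H) (x y h : H).

Local Notation S := (@antipode F H).

Section Integral.
Variable lam : dual H.
Hypothesis lam0 : lam != 0.
Hypothesis lamI : forall x, hitl lam x = lam x *: 1.

Lemma cointegral_exists : exists Lam, forall x, lam (x * Lam) = eps H x.
Proof. by have [Lam LE] := integral_repr pt lam0 lamI (eps H); exists Lam. Qed.

Variable Lam : H.
Hypothesis LamE : forall x, lam (x * Lam) = eps H x.

Lemma cointegral_mull x : x * Lam = eps H x *: Lam.
Proof.
apply: (integral_ndrE pt lam0 lamI) => y.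
by rewrite mulrA LamE -scalerAr dappZr LamE epsM mulrC.
Qed.

Lemma lam_cointegral : lam Lam = 1.
Proof. by rewrite -[Lam]mul1r LamE eps1. Qed.

Fact modular_linear : linear (fun x => lam (Lam * x) : F^o).
Proof. by lin. Qed.
(** The character by which [H] acts on the right of the left integral
    [Lam]. *)
Definition modular : dual H := mkdual modular_linear.

Lemma modularE x : modular x = lam (Lam * x).
Proof. exact: mkdualE. Qed.

Lemma cointegral_mulr x : Lam * x = modular x *: Lam.
Proof.
apply: (integral_ndrE pt lam0 lamI) => y.
by rewrite mulrA cointegral_mull -scalerAl -scalerAr !dappZr LamE modularE mulrC.
Qed.

Lemma modularM x y : modular (x * y) = modular x * modular y.
Proof. by rewrite modularE mulrA cointegral_mulr -scalerAl dappZr -modularE. Qed.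

Lemma modular1 : modular 1 = 1.
Proof. by rewrite modularE mulr1 lam_cointegral. Qed.

(** The distinguished grouplike element, which by [conv_integral] gives the
    eigenvalue of right multiplication by functionals on [lam]. *)
Definition dgrouplike : H := hitr lam Lam.
Local Notation g := dgrouplike.

(** The functional [conv lam p] is again an integral, hence proportional to
    [lam]; the factor is found by evaluation at [Lam]. *)
Lemma conv_integral p : conv lam p = p g *: lam.
Proof.
have [x|k e] := @integral_unique _ _ pt lam lam0 lamI (conv lam p).
  apply/eqP; rewrite -subr_eq0; apply/eqP/dual_sep => q.
  rewrite dappBr -convEl convA.
  have -> : conv q lam = q 1 *: lam.
    by apply: dual_ext => y; rewrite convEl lamI !dappZr dappZ mulrC.
  by rewrite dappZr convEl dappZ -convEl mulrC subrr.
by rewrite e; congr (_ *: _); rewrite -convEr e dappZ lam_cointegral mulr1.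
Qed.

Lemma hitr_integral x : hitr lam x = lam x *: g.
Proof.
apply/eqP; rewrite -subr_eq0; apply/eqP/dual_sep => p.
by rewrite dappBr -convEr conv_integral dappZr dappZ mulrC subrr.
Qed.

Lemma dgrouplikeP : is_grouplike g.
Proof.
apply/andP; split.
  apply: contra_neq (oner_neq0 F) => g0.
  by rewrite -lam_cointegral -eps_hitr -/g g0 dapp0.
apply/eqP/comul_sep => p q; rewrite tlift_pure; [|by lin..].
rewrite -[conv p q g](convEr lam) convA conv_integral convEl dappZ -convEl.
by rewrite conv_integral dappZ lam_cointegral mulr1.
Qed.

(** The mirror image of [integral_swap], proved in the same way from
    [hitr_integral]: the trivial eigenvalue 1 of the integral property is
    replaced by [g]. *)
Lemma integral_swap_r x y :
  sw (fun c d => lam (c * y) *: d) x = sw (fun a b => lam (x * a) *: (g * S b)) y.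
Proof.
pose k c d e f b : H := lam (c * e) *: (d * (f * S b)).
transitivity (sw (fun c d => sw (fun e b' => sw (fun f b => k c d e f b) b') y) x).
  apply: eq_sw => c d.
  rewrite -(sw_epsr (f := fun e => lam (c * e) *: d)); last by lin.
  apply: eq_sw => e b'.
  rewrite (sw_antipoder (f := fun z => lam (c * e) *: (d * z))).
    by rewrite mulr1.
  by lin.
rewrite sw_swap; under eq_sw => e b' do rewrite sw_swap.
rewrite -(sw_coassoc (t := fun e f b => sw (fun c d => k c d e f b) x));
  [|by rewrite /k; lin..].
apply: eq_sw => a b; rewrite -sw_swap.
transitivity (hitr lam (x * a) * S b); last by rewrite hitr_integral scalerAl.
rewrite hitr_mul (sw_lin (f := fun z => z * S b)); last by lin.
apply: eq_sw => c d; rewrite (sw_lin (f := fun z => z * S b)); last by lin.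
by apply: eq_sw => e f; rewrite /k -scalerAl mulrA.
Qed.

Lemma cointegral_antipode x : sw (fun a b => lam (x * b) *: a) Lam = S x.
Proof.
rewrite (integral_swap lamI) -(sw_epsr (f := S)); last by lin.
by apply: eq_sw => a b; rewrite LamE.
Qed.

(** Choose [z] with [lam(x y) = lam(z x)] for all [x], so that [z] is the image
    of [y] under the Nakayama automorphism of [lam].  The formulas
    [integral_swap] and [integral_swap_r], each used for the two pairs
    [(Lam, y)] and [(z, Lam)], express [S^2 z] as [hitl modular y] and [z] as
    [g S(g S(hitr modular y))]. *)
Lemma radford_formula y :
  hitl modular y = g * S (S (S (S (hitr modular y)))) * S g.
Proof.
have ly : linear (fun x => lam (x * y) : F^o) by lin.
have [z zE] := integral_reprl pt lam0 lamI (mkdual ly).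
have {}zE x : lam (x * y) = lam (z * x) by rewrite -zE mkdualE.
have -> : hitl modular y = S (S z).
  rewrite -(cointegral_antipode z) (sw_lin (f := S)); last by lin.
  under eq_sw => a b do rewrite linearZ -zE.
  rewrite -(integral_swap lamI); apply: eq_sw => a b; by rewrite modularE.
have -> : z = g * S (g * S (hitr modular y)).
  have lS : linear (fun x => g * S x) by lin.
  transitivity (sw (fun a b => lam (a * Lam) *: b) z).
    rewrite -[LHS](hitr_eps z); apply: eq_sw => a b; by rewrite LamE.
  rewrite integral_swap_r.
  transitivity (g * S (sw (fun a b => lam (z * a) *: b) Lam)).
    rewrite (sw_lin _ _ lS); apply: eq_sw => a b.
    by rewrite [RHS](linear_eqZ _ _ lS).
  under eq_sw => a b do rewrite -zE.
  rewrite integral_swap_r; congr (g * S _).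
  rewrite /hitr (sw_lin _ _ lS); apply: eq_sw => a b.
  by rewrite modularE [RHS](linear_eqZ _ _ lS).
by rewrite !antipodeM !(antipode2_grouplike dgrouplikeP) mulrA.
Qed.

End Integral.

Theorem radford : exists (g : H) (alpha : dual H),
  [/\ is_grouplike g, forall x y, alpha (x * y) = alpha x * alpha y, alpha 1 = 1 &
  forall y, hitl alpha y = g * S (S (S (S (hitr alpha y)))) * S g].
Proof.
have [lam lam0 lamI] := integral_exists pt.
have [Lam LE] := cointegral_exists lam0 lamI.
exists (dgrouplike lam Lam), (modular lam Lam); split.
- exact: (dgrouplikeP lam0 lamI LE).
- exact: (modularM lam0 lamI LE).
- exact: (modular1 LE).
- exact: (radford_formula lam0 lamI LE).
Qed.

End Formula.

(** * Finite order of the antipode *)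

Section Iter.
Variable T : Type.
Implicit Types f g : T -> T.

Lemma iter_comm f g n x : (forall y, f (g y) = g (f y)) ->
  iter n f (g x) = g (iter n f x).
Proof. by move=> c; elim: n => //= n ->. Qed.

Lemma iter_comp f g n x : (forall y, f (g y) = g (f y)) ->
  iter n (fun y => f (g y)) x = iter n f (iter n g x).
Proof.
by move=> c; elim: n => //= n ->; rewrite (iter_comm _ _ c).
Qed.

Lemma iter_id f n : (forall x, f x = x) -> forall x, iter n f x = x.
Proof. by move=> fx x; elim: n => //= n ->. Qed.

Lemma iter_mul f m n x : iter (m * n) f x = iter m (iter n f) x.
Proof. by elim: m => //= m IH; rewrite mulSn iterD IH. Qed.
End Iter.

Section Characters.
Variables (F : fieldType) (H : hopfAlgType F).
Implicit Types (p q : dual H) (x y : H).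
Local Notation S := (@antipode F H).

Definition algchar p := p 1 = 1 /\ forall x y, p (x * y) = p x * p y.

(** Dedekind's independence of characters: if [p] is the combination of the
    [X i] with coefficients [c i p], expanding [p(x y) = p(x) p(y)] and
    comparing coefficients gives [c i p * X i = c i p * p] for every [i]. *)
Lemma algchar_free (s : seq (dual H)) :
  uniq s -> {in s, forall p, algchar p} -> free s.
Proof.
elim: s => [|p s IHs] /=; first by rewrite nil_free.
case/andP=> pNs Us ch; have {IHs} fs : free s.
  by apply: IHs => // q qs; apply: ch; rewrite inE qs orbT.
rewrite free_cons fs andbT; apply/negP => ps.
have [p1 pM] := ch p (mem_head _ _).
pose c := coord (in_tuple s); pose X (i : 'I_(size s)) : dual H := s`_i.
have pE : p = \sum_i c i p *: X i by exact: (coord_span (X := in_tuple s) ps).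
have Xs i : X i \in s by exact: mem_nth.
have XM i : algchar (X i) by apply: ch; rewrite inE Xs orbT.
have pev x : p x = \sum_i c i p * X i x.
  by rewrite {1}pE dapp_sum; apply: eq_bigr => i _; rewrite dappZ.
have cX i x : c i p * X i x = c i p * p x.
  apply/eqP; rewrite -subr_eq0 -mulrBr; apply/eqP.
  have /freeP fX : free (in_tuple s) by [].
  apply: (fX (fun i => c i p * (X i x - p x))) i.
  apply: dual_ext => y; rewrite dapp0l dapp_sum.
  transitivity (p (x * y) - p x * p y); last by rewrite pM subrr.
  rewrite !pev mulr_sumr -sumrB; apply: eq_bigr => j _.
  rewrite dappZ (XM j).2 -/(X j) mulrBr mulrBl mulrA.
  by congr (_ - _); rewrite mulrCA mulrA.
have [i ci] : exists i, c i p != 0.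
  apply: contrapT => ne; case/negP: (oner_neq0 F); rewrite -p1 pE dapp_sum.
  apply/eqP; rewrite big1 // => i _.
  rewrite dappZ (_ : c i p = 0) ?mul0r //.
  by apply/eqP/negPn/negP => ci; apply: ne; exists i.
case/negP: pNs; suff -> : p = X i by exact: Xs.
by apply: dual_ext => x; apply: (mulfI ci); rewrite cX.
Qed.

Lemma hitl_algchar p x y : algchar p -> hitl p (x * y) = hitl p x * hitl p y.
Proof.
case=> _ pM; rewrite hitl_mul {1}/hitl.
rewrite (sw_lin (f := fun z => z * hitl p y)); last by lin.
apply: eq_sw => a b; rewrite /hitl.
rewrite (sw_lin (f := fun z => p b *: a * z)); last by lin.
by apply: eq_sw => c d; rewrite pM -scalerAl -scalerAr scalerA.
Qed.

Lemma hitr_algchar p x y : algchar p -> hitr p (x * y) = hitr p x * hitr p y.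
Proof.
case=> _ pM; rewrite hitr_mul {1}/hitr.
rewrite (sw_lin (f := fun z => z * hitr p y)); last by lin.
apply: eq_sw => a b; rewrite /hitr.
rewrite (sw_lin (f := fun z => p a *: b * z)); last by lin.
by apply: eq_sw => c d; rewrite pM -scalerAl -scalerAr scalerA.
Qed.

Lemma algchar_eps : algchar (eps H).
Proof. by split; [exact: eps1|exact: epsM]. Qed.

Lemma algchar_conv p q : algchar p -> algchar q -> algchar (conv p q).
Proof.
move=> [p1 pM] cq; split=> [|x y].
  by rewrite conv_grouplike ?is_grouplike1 // p1 cq.1 mulr1.
by rewrite !convEl hitl_algchar // pM.
Qed.

Lemma algchar_linv p : algchar p ->
  exists q, conv q p = eps H.
Proof.
case=> p1 pM; have l : linear (fun x => p (S x) : F^o) by lin.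
exists (mkdual l); apply: dual_ext => x; rewrite convE.
have lp : linear (fun z => p z : F^o) by lin.
rewrite -[RHS]mulr1 -p1 -[_ * _](sw_antipodel x lp); apply: eq_sws => a b.
by rewrite mkdualE pM.
Qed.

(** There are more powers of [p] than the dimension of the dual space allows
    for distinct characters, so two of them coincide. *)
Lemma algchar_order p : algchar p ->
  exists2 n, (0 < n)%N & iter n (conv p) (eps H) = eps H.
Proof.
move=> cp; pose P k := iter k (conv p) (eps H).
have cP k : algchar (P k).
  by elim: k => [|k IH]; [exact: algchar_eps|exact: algchar_conv].
have : ~~ uniq [seq P k | k <- iota 0 (\dim {:H}).+1].
  apply/negP => U; have fr : free [seq P k | k <- iota 0 (\dim {:H}).+1].
    by apply: algchar_free => // _ /mapP[k _ ->].
  have := dimvS (subvf <<[seq P k | k <- iota 0 (\dim {:H}).+1]>>).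
  by rewrite (eqP fr) size_map size_iota dual_dim ltnn.
case/(uniqPn 0) => i [j]; rewrite size_map size_iota => -[ij jn].
rewrite !(nth_map 0%N) ?size_iota ?(ltn_trans ij jn) //.
rewrite !nth_iota ?(ltn_trans ij jn) //.
rewrite !add0n => e; have [q qp] := algchar_linv cp.
exists (j - i)%N; first by rewrite subn_gt0.
have {jn}: P i = P (i + (j - i))%N by rewrite subnKC // ltnW.
rewrite -/(P _); move: (j - i)%N => d; elim: {e ij} i => [//|i IH].
by rewrite addSn /= => /(congr1 (conv q)); rewrite !convA qp !conv1p => /IH.
Qed.

Lemma hitl_iter p n x : iter n (hitl p) x = hitl (iter n (conv p) (eps H)) x.
Proof. by elim: n => [|n IH] /=; rewrite ?hitl_eps // IH hitl_hitl. Qed.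

Lemma conv_iterC p n :
  conv p (iter n (conv p) (eps H)) = conv (iter n (conv p) (eps H)) p.
Proof.
elim: n => [|n IH] /=; first by rewrite convp1 conv1p.
by rewrite {1}IH convA.
Qed.

Lemma hitr_iter p n x : iter n (hitr p) x = hitr (iter n (conv p) (eps H)) x.
Proof.
elim: n => [|n IH] /=; first by rewrite hitr_eps.
by rewrite IH hitr_hitr conv_iterC.
Qed.

End Characters.

Section Order.
Variables (F : fieldType) (H : hopfAlgType F).
Hypothesis pt : pointed_coalg H.
Local Notation S := (@antipode F H).

Lemma val_expg (g : grouplike H) n :
  grouplike_val (g ^+ n)%g = grouplike_val g ^+ n.
Proof. by elim: n => [|n IH]; rewrite ?expg0 ?expr0 // expgS exprS -IH. Qed.

Lemma grouplike_exponent (g : H) : is_grouplike g ->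
  g ^+ exponent [set: grouplike H] = 1.
Proof.
move=> gg; have := val_expg (Grouplike gg) (exponent [set: grouplike H]).
by rewrite expg_exponent ?inE.
Qed.

Lemma iter_conj (g h x : H) n : iter n (fun y => g * y * h) x = g ^+ n * x * h ^+ n.
Proof.
elim: n => [|n IH] /=; first by rewrite !expr0 mul1r mulr1.
by rewrite IH exprS [h ^+ n.+1]exprSr !mulrA.
Qed.

(** Radford's formula writes [S^4] as [C A B^-1], where [C] is the conjugation
    by [g^-1], and [A] and [B] are the two actions of [alpha].  These three maps
    commute and have finite order. *)
Lemma antipode_finite_order : exists2 n, (0 < n)%N &
  forall x, iter n (fun x => S (S x)) x = x.
Proof.
have [g [al [gg alM al1 rad]]] := radford pt.
have cal : algchar al by [].
have [m m0 em] := algchar_order cal.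
pose N := exponent [set: grouplike H].
have N0 : (0 < N)%N by exact: exponent_gt0.
pose P x := S (S (S (S x))).
pose C x := S g * x * g; pose A := hitl al; pose B := hitr al.
have Sgg := antipode_grouplike_mull gg; have gSg := antipode_grouplike_mulr gg.
have PB y : P (B y) = C (A y).
  by rewrite /C /A rad -/(P _) !mulrA Sgg mul1r -mulrA Sgg mulr1.
have Am x : iter m A x = x by rewrite hitl_iter em hitl_eps.
have Bm x : iter m B x = x by rewrite hitr_iter em hitr_eps.
have PE x : P x = C (A (iter m.-1 B x)).
  by rewrite -PB -iterS prednK // Bm.
have Cn x : iter N C x = x.
  by rewrite iter_conj !grouplike_exponent ?mulr1 ?mul1r //; exact: is_grouplikeV.
have AB x : A (B x) = B (A x) by exact: hitl_hitr.
have alg : al g * al (S g) = 1 by rewrite -alM gSg.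
have CA x : C (A x) = A (C x).
  rewrite /A /C !hitl_algchar // (hitl_grouplike al gg)
    (hitl_grouplike al (is_grouplikeV gg)).
  by rewrite -scalerAr -!scalerAl scalerA alg scale1r.
have CB x : C (B x) = B (C x).
  rewrite /B /C !hitr_algchar // (hitr_grouplike al gg)
    (hitr_grouplike al (is_grouplikeV gg)).
  by rewrite -scalerAr -!scalerAl scalerA alg scale1r.
exists (N * m * 2)%N; first by rewrite !muln_gt0 N0 m0.
move=> x; rewrite iter_mul.
have -> : iter (N * m) (iter 2 (fun x => S (S x))) x =
    iter (N * m) (fun x => C (A (iter m.-1 B x))) x.
  by apply: eq_iter => y; rewrite -PE.
rewrite (iter_comp (f := C) (g := fun x => A (iter m.-1 B x))); last first.
  by move=> y; rewrite CA; congr (A _); rewrite iter_comm.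
rewrite (iter_comp (f := A) (g := iter m.-1 B)); last first.
  by move=> y; rewrite iter_comm.
have -> : iter (N * m) (iter m.-1 B) x = x.
  by rewrite -iter_mul -mulnA [(m * _)%N]mulnC mulnA iter_mul iter_id.
have -> : iter (N * m) A x = x by rewrite iter_mul iter_id.
by rewrite mulnC iter_mul iter_id.
Qed.
End Order.

(** * Endomorphisms fixing the grouplike and skew primitive elements *)

Section Unipotent.
Variables (F : fieldType) (H : hopfAlgType F).
Hypothesis pt : pointed_coalg H.
Hypothesis char0 : forall n, (0 < n)%N -> n%:R != 0 :> F.
Implicit Types (p q : dual H) (x y : H) (C : {vspace H}).

Definition skew_primitive (a b y : H) := comul y = pure y a + pure b y.

Variable f : H -> H.
Hypothesis lf : linear f.
Hypothesis f_sw : forall (V : vectType F) (b : H -> H -> V) x,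
  (forall y, linear (b^~ y)) -> (forall x, linear (b x)) ->
  sw b (f x) = sw (fun a c => b (f a) (f c)) x.
Hypothesis f_grouplike : forall a, is_grouplike a -> f a = a.
Hypothesis f_skew : forall a b y, is_grouplike a -> is_grouplike b ->
  skew_primitive a b y -> f y = y.
Variable M : nat.
Hypothesis M0 : (0 < M)%N.
Hypothesis fM : forall x, iter M f x = x.

Let fD x y : f (x + y) = f x + f y.
Proof. by have := lf 1 x y; rewrite !scale1r. Qed.

Let fZ k x : f (k *: x) = k *: f x.
Proof. exact: linear_eqZ. Qed.

(** The two conditions on [x] say that its coproduct is [x (x) a] modulo
    [C (x) H] and [b (x) x] modulo [H (x) C].  The coproduct of [y = f x - x] is
    computed against [p (x) q] by applying [f] to one tensor factor at a time,
    so that the remainder is each time an element of [C], fixed by [f]. *)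
Lemma fixed_extend C a b x : {in C, forall c, f c = c} ->
  is_grouplike a -> is_grouplike b ->
  (forall q, hitl q x - q a *: x \in C) ->
  (forall q, hitr q x - q b *: x \in C) -> f x = x.
Proof.
move=> fC ga gb xa xb; set y := f x - x.
have fx : f x = x + y by rewrite addrCA subrr addr0.
have shift k z : z - k *: x \in C -> f z = z + k *: y.
  move=> zC; rewrite -{1}[z](subrK (k *: x)) fD fZ fC // fx scalerDr addrA.
  by rewrite subrK.
have lp p : linear (fun z => p (f z) : F^o) by apply: linear_dapp.
have sk : skew_primitive a b y.
  apply: comul_sep => p q; rewrite tliftD !tlift_pure; [|by lin..].
  pose pf := mkdual (lp p); pose qf := mkdual (lp q).
  have cf : conv p q (f x) = conv pf qf x.
    rewrite !convE (f_sw (V := F^o)); [|by lin..].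
    by apply: eq_sws => c d; rewrite !mkdualE.
  rewrite dappBr cf convEl mkdualE (shift (q a)); last first.
    by have := xa qf; rewrite mkdualE f_grouplike.
  rewrite dappDr dappZr -convEl convEr mkdualE (shift (p b)) //.
  by rewrite dappDr dappZr -convEr addrAC [conv p q x + _]addrC addrK addrC mulrC.
have fy : f y = y := f_skew ga gb sk.
have fn n : iter n f x = x + y *+ n.
  elim: n => [|n IH]; first by rewrite addr0.
  by rewrite iterS IH fD fx -scaler_nat fZ fy scaler_nat -addrA -mulrS.
have := fM x; rewrite fn => /eqP; rewrite -subr_eq0 addrAC subrr add0r.
rewrite -scaler_nat scaler_eq0 (negPf (char0 M0)) /= => /eqP y0.
by rewrite fx y0 addr0.
Qed.

(** If [C] is proper, the action [hitl] on [H / C] has an eigenvector [x1]; the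
    vectors with the same eigenvalue are closed under [hitr], which commutes
    with [hitl], and among them there is an eigenvector [w] of [hitr].  The
    subcoalgebra spanned by [C] and [w] is fixed as well. *)
Lemma fixed_subcoalg k C : (\dim {:H} - \dim C <= k)%N ->
  (forall p x, x \in C -> hitl p x \in C) ->
  (forall p x, x \in C -> hitr p x \in C) ->
  (forall a, is_grouplike a -> a \in C) ->
  {in C, forall c, f c = c} -> forall x, f x = x.
Proof.
elim: k C => [|k IH] C dC lC rC gC fC x.
  apply: fC; suff -> : C = fullv by rewrite memvf.
  by apply/eqP; rewrite eqEdim subvf /= -subn_eq0 -leqn0.
have [CH|CH] := eqVneq C fullv; first by apply: fC; rewrite CH memvf.
have [z zC] : exists z, z \notin C.
  apply: contrapT => nz; case/negP: CH; rewrite eqEsubv subvf /=.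
  by apply/subvP => z _; apply/negPn/negP => zC; apply: nz; exists z.
have [//||a [x1 [ga _ x1C x1a]]] := @socle_hitl _ _ pt (fun _ => True) C lC.
  by exists z.
pose U x := forall q, hitl q x - q a *: x \in C.
have sU p w : U w -> U (hitr p w).
  move=> Uw q; rewrite hitl_hitr.
  rewrite -(linear_eqZ (f := hitr p)); last by lin.
  have := rC p _ (Uw q); have lr : linear (hitr p) by lin.
  by rewrite -(mkhomE lr) linearB /= !mkhomE.
have [|b [w [gb Uw wC wb]]] := @socle_hitr _ _ pt U C rC sU.
  by exists x1.
have fw : f w = w by apply: (fixed_extend fC ga gb).
have inD u : u \in (C + <[w]>)%VS -> exists2 c, c \in C & exists k, u = c + k *: w.
  by case/memv_addP => c cC [_ /vlineP[l ->] ->]; exists c => //; exists l.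
have Cs c : c \in C -> c \in (C + <[w]>)%VS by apply/subvP/addvSl.
have ws l : l *: w \in (C + <[w]>)%VS.
  by apply: memvZ; apply: (subvP (addvSr _ _)); apply: memv_line.
apply: (IH (C + <[w]>)%VS).
- rewrite -ltnS (leq_trans _ dC) //; apply: ltn_sub2l; last first.
    rewrite ltnNge; apply: contra wC => d.
    suff -> : C = (C + <[w]>)%VS by have := ws 1; rewrite scale1r.
    by apply/eqP; rewrite eqEdim addvSl.
  rewrite ltnNge; apply: contra CH => d.
  by rewrite eqEdim subvf.
- move=> p u /inD[c cC [l ->]]; have lh : linear (hitl p) by lin.
  rewrite addrC lh -[hitl p w](subrK (p a *: w)) scalerDr -addrA scalerA.
  by rewrite memvD ?memvD ?ws ?Cs ?lC ?memvZ ?Uw.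
- move=> p u /inD[c cC [l ->]]; have lh : linear (hitr p) by lin.
  rewrite addrC lh -[hitr p w](subrK (p b *: w)) scalerDr -addrA scalerA.
  by rewrite memvD ?memvD ?ws ?Cs ?rC ?memvZ ?wb.
- by move=> c /gC/Cs.
- by move=> u /inD[c cC [l ->]]; rewrite fD fZ fw fC.
Qed.

Lemma fixed_all x : f x = x.
Proof.
have [s hs] := grouplike_fin H; pose t := filter (@is_grouplike F H) s.
have tg a : a \in t -> is_grouplike a by rewrite mem_filter => /andP[].
have sub (g : 'End(H)) : (forall a, is_grouplike a -> exists k, g a = k *: a) ->
    forall z, z \in <<t>>%VS -> g z \in <<t>>%VS.
  move=> gE z zt; rewrite memv_preim; move: z zt; apply/subvP/span_subvP => a at_.
  rewrite -memv_preim; have [k ->] := gE a (tg a at_).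
  by apply/memvZ/memv_span.
apply: (@fixed_subcoalg (\dim {:H}) <<t>>%VS); first exact: leq_subr.
- move=> p z zt; have lh : linear (hitl p) by lin.
  rewrite -(mkhomE lh); apply: sub => // a ga; exists (p a).
  by rewrite mkhomE hitl_grouplike.
- move=> p z zt; have lh : linear (hitr p) by lin.
  rewrite -(mkhomE lh); apply: sub => // a ga; exists (p a).
  by rewrite mkhomE hitr_grouplike.
- by move=> a ga; apply: memv_span; rewrite mem_filter ga hs.
move=> c ct; apply/eqP; rewrite -subr_eq0.
have ld : linear (fun z => f z - z).
  by move=> k u v; rewrite lf scalerBr opprD !addrA; congr (_ + _); rewrite addrAC.
rewrite -(mkhomE ld) -memv_ker; move: c ct; apply/subvP/span_subvP => a at_.
by rewrite memv_ker mkhomE f_grouplike ?subrr ?tg.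
Qed.

End Unipotent.

Section SkewPrimitive.
Variables (F : fieldType) (H : hopfAlgType F).
Implicit Types (x y : H).
Local Notation S := (@antipode F H).

(** The antipode axiom applied to [y] gives [S y = - b^-1 y a^-1]. *)
Lemma antipode2_skew_primitive a b y :
  is_grouplike a -> is_grouplike b -> skew_primitive a b y ->
  S (S y) = (a * S b) * y * (S a * b).
Proof.
move=> ga gb sk.
have swy (V : vectType F) (t : H -> H -> V) :
    (forall y, linear (t^~ y)) -> (forall x, linear (t x)) ->
    sw t y = t y a + t b y.
  by move=> l1 l2; rewrite /sw sk tliftD !tlift_pure.
have ey : eps H y = 0.
  have /andP[b0 _] := gb; apply/eqP.
  move: (hitl_eps y); rewrite /hitl swy; [|by lin..].
  rewrite !epsE (counit_grouplike ga) scale1r => /eqP.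
  by rewrite -subr_eq0 addrAC subrr add0r scaler_eq0 (negPf b0) orbF.
have Sy : S y = - (S b * y * S a).
  have := sw_antipodel y (linear_id (V := H)).
  rewrite swy ?ey ?scale0r; [|by lin..].
  move/eqP; rewrite addr_eq0 => /eqP /(congr1 (fun z => z * S a)).
  by rewrite -mulrA antipode_grouplike_mulr // mulr1 mulNr.
rewrite Sy linearN /= !antipodeM !antipode2_grouplike // Sy.
by rewrite mulNr mulrN opprK !mulrA.
Qed.

Lemma iter_antipode2_skew_primitive a b y n :
  is_grouplike a -> is_grouplike b -> skew_primitive a b y ->
  iter n (fun x => S (S x)) y = (a * S b) ^+ n * y * (S a * b) ^+ n.
Proof.
move=> ga gb sk; rewrite -iter_conj.
have := antipode2_skew_primitive ga gb sk.
have : is_grouplike (S a * b) by apply: is_grouplikeM (is_grouplikeV ga) gb.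
have : is_grouplike (a * S b) by apply: is_grouplikeM ga (is_grouplikeV gb).
move: (a * S b) (S a * b) => u v gu gv Sy.
elim: n => [//|n IH]; rewrite iterS IH.
rewrite -(iter_comm (f := fun x => u * x * v) (g := fun x => S (S x))).
  by rewrite Sy -iterSr.
move=> z; rewrite !antipodeM.
by rewrite (antipode2_grouplike gu) (antipode2_grouplike gv).
Qed.

Lemma sw_iter_antipode2 (V : vectType F) (b : H -> H -> V) n x :
  (forall y, linear (b^~ y)) -> (forall x, linear (b x)) ->
  let f := iter n (fun x => S (S x)) in
  sw b (f x) = sw (fun a c => b (f a) (f c)) x.
Proof.
elim: n b x => [//|n IH] b x l1 l2 /=.
rewrite sw_antipode // sw_antipode; last 2 first.
- by move=> y; apply: (linear_comp (l2 _)); lin.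
- by move=> y; apply: (linear_comp (l1 _)); lin.
rewrite IH //.
- by move=> y; apply: (linear_comp (l1 _)); lin.
- by move=> y; apply: (linear_comp (l2 _)); lin.
Qed.

Lemma linear_iter (f : H -> H) n : linear f -> linear (iter n f).
Proof. by move=> lf; elim: n => [//|n IH] k u v; rewrite /= IH lf. Qed.

End SkewPrimitive.

Lemma iter_antipode2_exponent (F : fieldType) (H : hopfAlgType F) :
  (forall n, (0 < n)%N -> n%:R != 0 :> F) -> pointed_coalg H ->
  forall x, iter (exponent [set: grouplike H])
    (fun x : H => antipode (antipode x)) x = x.
Proof.
move=> char0 pt x; have [M M0 SM] := antipode_finite_order pt.
set N := exponent _; pose s2 (x : H) := antipode (antipode x).
have fix_gl a : is_grouplike a -> iter N s2 a = a.
  by move=> ga; elim: N => //= n ->; apply: antipode2_grouplike.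
apply: (@fixed_all F H pt char0 (iter N s2) _ _ _ _ M M0) => //.
- by apply: linear_iter; lin.
- by move=> V b z l1 l2; apply: sw_iter_antipode2.
- move=> a b y ga gb sk; rewrite (iter_antipode2_skew_primitive _ ga gb sk).
  have gSa := is_grouplikeV ga; have gSb := is_grouplikeV gb.
  by rewrite !grouplike_exponent ?mul1r ?mulr1 //; apply: is_grouplikeM.
by move=> z; rewrite -iter_mul mulnC iter_mul iter_id.
Qed.

(** The remainder of [n] modulo the order is again a period. *)
Lemma fun_order_dvd (T : Type) (f : T -> T) n :
  (0 < n)%N -> iter n f =1 id -> (fun_order f %| n)%N.
Proof.
move=> n0 fn; rewrite /fun_order; case: pselect => [ex|[]]; last first.
  by exists n; rewrite n0; apply/asboolP.
case: ex_minnP => m /andP[m0 /asboolP fm] minm.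
rewrite /dvdn -leqn0 leqNgt; apply/negP => r0.
suff /minm : (0 < n %% m)%N && `[< iter (n %% m) f =1 id >].
  by rewrite leqNgt ltn_mod m0.
rewrite r0; apply/asboolP => x; rewrite -[RHS]fn {2}(divn_eq n m) addnC iterD.
by rewrite iter_mul (iter_id (f := iter m f)).
Qed.

Theorem theorem4p4 (R : realType) (H : hopfAlgType R[i]) :
  pointed_coalg H ->
  (fun_order ((@antipode _ H) \o (@antipode _ H))
     %| exponent [set: grouplike H])%N.
Proof.
move=> pt; apply: fun_order_dvd; first exact: exponent_gt0.
apply: iter_antipode2_exponent => // n n0.
by rewrite Num.Theory.pnatr_eq0 -lt0n.
Qed.
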